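(* (1) Let $m,n\geq 2$, let $(p_1,\dots,p_n)$ and $(q_1,\dots,q_m)$ be tuples of distinct primes, and let $G=F(p_1,\dots,p_n)$ and $H=F(q_1,\dots,q_m)$ be the corresponding Brown-Stein-Thompson groups. If $m>n$, then $H$ does not embed in $G$. (2) The Bieri-Strebel group $G(I;A_1,P_1)$ does not embed into the Bieri-Strebel group $G(I;A_2,P_2)$ if the abelian rank of $P_1$ is greater than that of $P_2$.
   Context: For distinct primes $p_1,\dots,p_n$, $F(p_1,\dots,p_n)$ is the group of orientation preserving piecewise linear homeomorphisms of $[0,1]$ with finitely many breakpoints, whose slopes, wherever they exist, lie in the multiplicative group $\langle p_1,\dots,p_n\rangle<\mathbf{R}_+^*$, and whose breakpoints lie in $\mathbf{Z}[\frac{1}{p_1\cdots p_n}]\cap(0,1)$. Here $I$ is $\mathbf{R}$ or a compact interval of positive length, $\mathbf{R}_+^*$ is the multiplicative group of positive reals, and for $i=1,2$, $P_i$ is a subgroup of $\mathbf{R}_+^*$ and $A_i$ is a nonzero additive $\mathbf{Z}[P_i]$-submodule of $\mathbf{R}$. The Bieri-Strebel group $G(I;A,P)$ is the group of all orientation preserving piecewise linear homeomorphisms of $\mathbf{R}$ with finitely many breakpoints, with support (set of moved points) contained in $I$, slopes in $P$, breakpoints in $A$, and mapping $A$ onto $A$. The abelian rank of an abelian group $P$ is its torsion-free rank $\dim_{\mathbf{Q}}(P\otimes\mathbf{Q})$. ''Embeds'' means: there is an injective group homomorphism. *)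

(* Defs.v *)
From HB Require Import structures.
From mathcomp Require Import all_boot all_order all_algebra.
From mathcomp Require Import all_classical all_reals all_analysis.

Set Implicit Arguments.
Unset Strict Implicit.
Unset Printing Implicit Defensive.

Import Order.TTheory GRing.Theory Num.Theory.
Import numFieldNormedType.Exports.

Local Open Scope classical_set_scope.
Local Open Scope card_scope.
Local Open Scope ring_scope.

Record homeo (T : topologicalType) := Homeo {
  homeo_fun :> T -> T;
  homeo_inv : T -> T;
  homeo_funK : cancel homeo_fun homeo_inv;
  homeo_invK : cancel homeo_inv homeo_fun;
  homeo_continuous : continuous homeo_fun;
  homeo_inv_continuous : continuous homeo_inv
}.

Section HomeoGroup.
Variable T : topologicalType.
Implicit Types f g h : homeo T.

Lemma homeo_ext f g : f =1 g -> f = g.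
Proof.
case: f => f f' fK f'K cf cf'; case: g => g g' gK g'K cg cg' /= /funext fg.
move: fK f'K cf cf'; rewrite {}fg => fK f'K cf cf'.
have f'g' : f' = g' by apply/funext => x; rewrite -[in LHS](g'K x) fK.
move: fK f'K cf'; rewrite {}f'g' => fK f'K cf'.
by congr Homeo; exact: Prop_irrelevance.
Qed.

Definition homeo_one : homeo T :=
  Homeo (fun=> erefl) (fun=> erefl) (fun=> cvg_id) (fun=> cvg_id).

Definition homeo_mul f g : homeo T :=
  Homeo (can_comp (homeo_funK f) (homeo_funK g))
        (can_comp (homeo_invK g) (homeo_invK f))
        (fun x => continuous_comp (@homeo_continuous T g x)
                    (@homeo_continuous T f (g x)))
        (fun x => continuous_comp (@homeo_inv_continuous T f x)
                    (@homeo_inv_continuous T g (homeo_inv f x))).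

Definition homeo_V f : homeo T :=
  Homeo (homeo_invK f) (homeo_funK f)
        (@homeo_inv_continuous T f) (@homeo_continuous T f).

Lemma homeo_mulA : associative homeo_mul.
Proof. by move=> f g h; exact: homeo_ext. Qed.

Lemma homeo_mul1 : left_id homeo_one homeo_mul.
Proof. by move=> f; exact: homeo_ext. Qed.

Lemma homeo_mulr1 : right_id homeo_one homeo_mul.
Proof. by move=> f; exact: homeo_ext. Qed.

Lemma homeo_mulV : left_inverse homeo_one homeo_V homeo_mul.
Proof. by move=> f; apply: homeo_ext => x /=; rewrite homeo_funK. Qed.

Lemma homeo_mulrV : right_inverse homeo_one homeo_V homeo_mul.
Proof. by move=> f; apply: homeo_ext => x /=; rewrite homeo_invK. Qed.

HB.instance Definition _ := gen_eqMixin (homeo T).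
HB.instance Definition _ := gen_choiceMixin (homeo T).
HB.instance Definition _ := isGroup.Build (homeo T)
  homeo_mulA homeo_mul1 homeo_mulr1 homeo_mulV homeo_mulrV.

End HomeoGroup.

(* For subgroups G and H of gT and hT; as for the {morphism G >-> hT} of finite
   group theory, the values of phi outside G are irrelevant. *)
Definition embeds (gT hT : groupType) (G : set gT) (H : set hT) : Prop :=
  exists phi : gT -> hT,
    [/\ forall f, G f -> H (phi f),
        {in G &, {morph phi : f g / (f * g)%g}} &
        {in G &, injective phi}].

Section PiecewiseLinear.
Variable R : realType.

(* [coord : T -> R] is the inclusion of a one-dimensional domain in the line.
   At an end of [0, 1] the condition is one-sided, so that the breakpoints of a
   piecewise linear homeomorphism of [0, 1] all lie in ]0, 1[. *)
Definition has_slope (T : topologicalType) (coord : T -> R) (f : T -> T)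
    (x : T) (s : R) : Prop :=
  \forall y \near x, coord (f y) = coord (f x) + s * (coord y - coord x).

Definition breakpoints (T : topologicalType) (coord : T -> R) (f : T -> T) :
  set T := [set x | ~ exists s, has_slope coord f x s].

Definition PL_homeos (T : topologicalType) (coord : T -> R) (P B : set R) :
    set (homeo T) :=
  [set f | [/\ forall x y, coord x < coord y -> coord (f x) < coord (f y),
               finite_set (breakpoints coord f),
               forall x s, has_slope coord f x s -> P s &
               coord @` breakpoints coord f `<=` B]].

Definition pos_subgroup (P : set R) : Prop :=
  P `<=` [set x | 0 < x] /\ divr_closed [in P].

Definition pos_subgroup_gen (S : set R) : set R := smallest pos_subgroup S.

Definition subring_gen (S : set R) : set R :=
  smallest (fun B => subring_closed [in B]) S.

(* The action of the group ring of P on the line factors through the subring of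
   R generated by P. *)
Definition is_submodule (P A : set R) : Prop :=
  zmod_closed [in A] /\ forall c a, subring_gen P c -> A a -> A (c * a).

Definition compact_interval_or_line (I : set R) : Prop :=
  I = setT \/ exists a b : R, a < b /\ I = `[a, b]%classic.

Definition BieriStrebel (I A P : set R) : set (homeo R) :=
  PL_homeos idfun P A `&`
  [set f | [set x | f x != x] `<=` I /\ f @` A = A].

Definition unit_interval : topologicalType := set_type (`[0, 1]%classic : set R).

Definition BrownSteinThompson (n : nat) (p : n.-tuple nat) :
    set (homeo unit_interval) :=
  PL_homeos (set_val : unit_interval -> R)
    (pos_subgroup_gen [set q%:R | q in [set` p]])
    (subring_gen [set (\prod_(q <- p) q)%N%:R^-1] `&` `]0, 1[%classic).

End PiecewiseLinear.
Arguments BrownSteinThompson R {n} p _.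

Section AbelianRank.

Definition lin_indep (K : fieldType) (V : lmodType K) (B : set V) : Prop :=
  forall (s : seq V) (c : V -> K), uniq s -> [set` s] `<=` B ->
    \sum_(v <- s) c v *: v = 0 -> {in s, forall v, c v = 0}.

Definition spanning (K : fieldType) (V : lmodType K) (B : set V) : Prop :=
  forall u, exists (s : seq V) (c : V -> K),
    [set` s] `<=` B /\ u = \sum_(v <- s) c v *: v.

Definition is_basis (K : fieldType) (V : lmodType K) (B : set V) : Prop :=
  lin_indep B /\ spanning B.

(* Dimensions are cardinals, possibly infinite. *)
Definition dim_lt (K : fieldType) (V W : lmodType K) : Prop :=
  exists (B : set V) (C : set W),
    [/\ is_basis B, is_basis C, B #<= C & ~ (C #<= B)].

Definition mul_to_add (R : realType) (P : set R) (V : zmodType) (h : R -> V) :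
  Prop := {in P &, {morph h : x y / x * y >-> x + y}}.

(* V, with i x in the role of x (x) 1, is the tensor product over Z of the
   multiplicative group P with the rationals: the universal property of the
   extension of scalars from Z to rat. *)
Definition is_tensor_rat (R : realType) (P : set R) (V : lmodType rat)
    (i : R -> V) : Prop :=
  mul_to_add P i /\
  forall (W : lmodType rat) (h : R -> W), mul_to_add P h ->
    exists g : {linear V -> W},
      {in P, forall x, g (i x) = h x} /\
      forall g' : {linear V -> W}, {in P, forall x, g' (i x) = h x} -> g' =1 g.

Definition abelian_rank_lt (R : realType) (P Q : set R) : Prop :=
  exists (V W : lmodType rat) (i : R -> V) (j : R -> W),
    [/\ is_tensor_rat P i, is_tensor_rat Q j & dim_lt V W].

End AbelianRank.

(* Main.v *)
Require Import Defs.
From mathcomp Require Import all_boot all_order all_algebra.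
From mathcomp Require Import all_classical all_reals all_analysis.
From HB Require Import structures.
From mathcomp Require Import ring lra.

Set Implicit Arguments.
Unset Strict Implicit.
Unset Printing Implicit Defensive.

Import Order.TTheory GRing.Theory Num.Theory.
Import numFieldNormedType.Exports.

Local Open Scope classical_set_scope.
Local Open Scope ring_scope.

(** An embedding of one group of piecewise linear homeomorphisms into another
    transports slopes.  More precisely, let [P] be the group of slopes of the
    source and [Q] that of the target; then an embedding yields an injective
    homomorphism from [P] to [Q] (slope_hom_of_embedding), and the theorem
    becomes a statement on ranks.  In the source only the elements supported
    in a fixed segment matter, so both groups of the theorem can be replaced by
    a Bieri-Strebel group of a segment, and both targets by the group of all
    piecewise linear homeomorphisms of the line with slopes in [Q].

    The homomorphism is found as follows.  Let [phi] be the embedding.  Pick an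
    element [h] supported in a segment [a, c] and moving its inner points
    towards [a], and a small segment K that [h] moves off itself.  The elements
    supported in K commute with their conjugates by [h].  In the target, two
    commuting piecewise linear homeomorphisms have components of support that
    are equal or disjoint (fix_near_moved), and a germ at a fixed point has a
    slope, a multiplicative invariant.  Hence, if [u] is a commutator of
    elements supported in K, then [phi h] displaces each component of the
    support of [phi u] (commutator_wanders): if it preserved one, the ends of
    this component would be fixed by the image of the whole group supported
    in K, and [phi u] would have slope 1 there.  Taking double
    commutators makes the components bounded, as commutators are translations
    near infinity.  The iterates under [phi h] of
    such a component then converge to a point [y] fixed by [phi h], which is
    finite at one of its two ends because [phi h] also has a fixed point, as
    it commutes with the image of an element supported away from [a, c].  The
    iterates are components of the supports of elements concentrated near [a]
    or, in the other direction of time, near [c].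

    So there is an end [a] and a point [y] at which the images of elements
    concentrated near [a] act (clusters_at).  Elements trivial near [a] commute
    with these, so their images are trivial near [y] (phi_trivial_germ).
    Elements with a slope at [a] have images that fix [y]
    (phi_fixes_accumulation_point), and the slope at [y] depends only on the
    slope at [a].  Finally an element of slope less than 1 at [a] has a power
    moving a given segment near [a] off itself, so by the displacement argument
    its image is not trivial near [y] (phi_faithful_slope): the homomorphism
    of slopes is injective.

    For Bieri-Strebel groups, the homomorphism remains injective over the
    rationals, and Steinitz exchange in arbitrary cardinality compares the
    bases.  For primes, the images of more than [n] primes in a group generated
    by [n] numbers satisfy a multiplicative relation, contrary to unique
    factorization. *)

(** * Slopes of piecewise linear maps *)

Section Line.
Variable R : realType.
Implicit Types (x y z a b s t d : R).

Lemma nearR x (Q : R -> Prop) :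
  (\forall y \near x, Q y) <->
  exists2 d, 0 < d & forall y, x - d < y -> y < x + d -> Q y.
Proof.
split.
- move=> /nbhs_ballP[d /= d0 dQ]; exists d => // y xy yx; apply: dQ.
  by rewrite /ball /= ltr_norml; apply/andP; split; lra.
- move=> [d d0 dQ]; apply/nbhs_ballP; exists d => //= y.
  by rewrite /ball /= ltr_norml => /andP[? ?]; apply: dQ; lra.
Qed.

(** Connectedness of segments, in the form of an induction principle. *)
Lemma segment_clopen_ind (Q : R -> Prop) a b : Q a ->
  (forall x, a <= x <= b -> Q x -> \forall y \near x, Q y) ->
  (forall x, a <= x <= b -> ~ Q x -> \forall y \near x, ~ Q y) ->
  forall x, a <= x <= b -> Q x.
Proof.
move=> Qa oQ cQ x axb.
have ab : a <= b by lra.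
have inab z : (`[a, b]%classic : set R) z <-> a <= z <= b.
  by rewrite /= in_itv.
have := @segment_connected R a b ([set z | a <= z <= b] `&` Q).
move=> H; suff E : [set z | a <= z <= b] `&` Q = `[a, b]%classic.
  by suff [] : ([set z | a <= z <= b] `&` Q) x by []; rewrite E; apply/inab.
apply: H.
- by exists a; split => //=; rewrite lexx ab.
- exists (interior Q); first exact: open_interior.
  apply/seteqP; split=> z [/= zab zQ]; split.
  + exact/inab.
  + exact: oQ.
  + exact/inab.
  + exact: interior_subset zQ.
- exists (~` interior (~` Q)); first by rewrite closedC; exact: open_interior.
  apply/seteqP; split=> z [/= zab zQ]; split.
  + exact/inab.
  + by move=> /interior_subset.
  + exact/inab.
  + by apply: contrapT => nQ; apply: zQ; apply: cQ => //; apply/inab.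
Qed.

End Line.

Section Slopes.
Variables (R : realType) (T : topologicalType) (coord : T -> R).
Implicit Types (f g : T -> T) (x : T) (s t : R).

Lemma has_slope_near f x s :
  has_slope coord f x s -> \forall z \near x, has_slope coord f z s.
Proof.
rewrite /has_slope => /nbhs_interior fs; near=> z.
have zs : (interior (fun y => coord (f y) = coord (f x) + s * (coord y - coord x))) z.
  by near: z.
have := interior_subset zs => zE.
move: zs; rewrite /interior /=; apply: filterS => y ->; rewrite zE; ring.
Unshelve. all: by end_near.
Qed.

Lemma has_slope_comp f g x s t : {for x, continuous g} ->
  has_slope coord g x s -> has_slope coord f (g x) t ->
  has_slope coord (f \o g) x (t * s).
Proof.
move=> cg gs ft; near=> y => /=.
have -> : coord (f (g y)) = coord (f (g x)) + t * (coord (g y) - coord (g x)).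
  by near: y; exact: (cg _ ft).
have -> : coord (g y) = coord (g x) + s * (coord y - coord x) by near: y.
ring.
Unshelve. all: by end_near.
Qed.

End Slopes.

Section PL.
Variable R : realType.
Implicit Types (f g : R -> R) (x y z a b s t d : R) (P A : set R).

Lemma has_slopeP f x s : has_slope idfun f x s <->
  exists2 d, 0 < d & forall y, x - d < y -> y < x + d -> f y = f x + s * (y - x).
Proof. exact: nearR. Qed.

Lemma has_slope_uniq f x s t :
  has_slope idfun f x s -> has_slope idfun f x t -> s = t.
Proof.
move=> /has_slopeP[d d0 sd] /has_slopeP[e e0 te].
have m0 : 0 < Num.min d e by rewrite lt_min d0.
have md : Num.min d e <= d by rewrite ge_min lexx.
have me : Num.min d e <= e by rewrite ge_min lexx orbT.
set m := Num.min d e in m0 md me.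
have E1 := sd (x + m / 2) ltac:(lra) ltac:(lra).
have E2 := te (x + m / 2) ltac:(lra) ltac:(lra).
have m20 : m / 2 != 0 by rewrite mulf_neq0 ?gt_eqF.
apply: (mulIf m20); lra.
Qed.

(** The points near which [f] agrees with its affine germ at [x] form an open
    and closed subset of the segment. *)
Lemma affine_segment f x y s : x <= y ->
  (forall z, x <= z <= y -> exists t, has_slope idfun f z t) ->
  has_slope idfun f x s ->
  has_slope idfun f y s /\ f y = f x + s * (y - x).
Proof.
move=> xy slp sx.
suff H : forall z, x <= z <= y -> \forall u \near z, f u = f x + s * (u - x).
  have [d d0 Hd] := (nearR _ _).1 (H y ltac:(lra)).
  have E : f y = f x + s * (y - x) by apply: Hd; lra.
  split=> //; apply/has_slopeP; exists d => // u yu uy.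
  by rewrite E Hd //; ring.
apply: segment_clopen_ind.
- exact: sx.
- move=> z _ /(nbhs_interior); apply: filterS => u; exact.
- move=> z xzy nz; have [t /has_slopeP[d d0 td]] := slp z xzy.
  apply/nearR; exists d => // u zu uz /nearR[e e0 ue]; apply: nz.
  (* near u both affine expressions agree, hence they agree everywhere *)
  have [m m0 [me mu1 mu2]] : exists2 m, 0 < m & [/\ m <= e, m <= z + d - u & m <= u - (z - d)].
    exists (Num.min e (Num.min (z + d - u) (u - (z - d)))).
      by rewrite !lt_min e0; apply/andP; split=> //; lra.
    by split; rewrite ?ge_min ?lexx ?orbT //.
  have E0 := td u zu uz; have E0' := ue u ltac:(lra) ltac:(lra).
  have E1 := td (u + m / 2) ltac:(lra) ltac:(lra).
  have E1' := ue (u + m / 2) ltac:(lra) ltac:(lra).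
  have ts : t = s.
    have m20 : m / 2 != 0 by rewrite mulf_neq0 ?gt_eqF.
    apply: (mulIf m20); lra.
  apply/nearR; exists d => // v zv vz; rewrite td // ts; rewrite ts in E0.
  lra.
Qed.

Lemma affine_between f x y s : 
  (forall z, Num.min x y <= z <= Num.max x y -> exists t, has_slope idfun f z t) ->
  has_slope idfun f x s -> f y = f x + s * (y - x).
Proof.
move=> slp sx; have [xy|yx] := leP x y.
  apply: (affine_segment xy _ sx).2 => z.
  by have := slp z; rewrite min_l // max_r.
have slp' z : y <= z <= x -> exists t, has_slope idfun f z t.
  by have := slp z; rewrite min_r ?max_l // ltW.
have [t ty] := slp' y ltac:(lra).
have [tx E] := affine_segment (ltW yx) slp' ty.
rewrite E (has_slope_uniq sx tx); ring.
Qed.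

End PL.

(** * Increasing homeomorphisms of the line *)

Section FiniteSets.
Variable R : realType.
Implicit Types (B : set R) (x y d : R).

Lemma finite_right_gap B y : finite_set B ->
  exists2 d, 0 < d & forall x, y < x < y + d -> ~ B x.
Proof.
move=> /finite_seqP[s ->]; elim: s => [|b s [d d0 Hd]].
  by exists 1 => // x _; rewrite /= inE.
have [yb|by_] := ltP y b.
- exists (Num.min d (b - y)); first by rewrite lt_min d0 subr_gt0.
  move=> x /andP[yx]; rewrite -ltrBlDl lt_min => /andP[xd xb] /=.
  rewrite inE => /orP[/eqP xE|xs]; first by move: xb; rewrite xE ltxx.
  by apply: (Hd x) => //; lra.
- exists d => // x xy /=; rewrite inE => /orP[/eqP xE|xs].
    by lra.
  exact: (Hd x).
Qed.

Lemma finite_upper_gap B : finite_set B ->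
  exists M, forall x, M <= x -> ~ B x.
Proof.
move=> /finite_seqP[s ->]; elim: s => [|b s [M HM]].
  by exists 0 => x _; rewrite /= inE.
exists (Num.max M (b + 1)) => x; rewrite ge_max => /andP[Mx bx] /=.
rewrite inE => /orP[/eqP xE|xs]; first by lra.
exact: (HM x).
Qed.

Lemma finite_pigeonhole B (u : nat -> R) : finite_set B ->
  (forall n, u n < u n.+1) ->
  exists n, forall x, u n < x < u n.+1 -> ~ B x.
Proof.
move=> /finite_seqP[s ->] ui; apply: contrapT => /forallNP H.
have {}H n : exists x, (u n < x < u n.+1) /\ x \in s.
  have /existsNP[x /not_implyP[ux /contrapT xs]] := H n; by exists x.
have [b Hb] := choice H.
have bi m n : (m < n)%N -> b m < b n.
  have um i j : (i <= j)%N -> u i <= u j.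
    elim: j => [|j IH]; first by rewrite leqn0 => /eqP->.
    rewrite leq_eqVlt => /orP[/eqP->//|/IH ij].
    by rewrite (le_trans ij) // ltW.
  move=> mn; have [/andP[_ bm] _] := Hb m; have [/andP[bn _] _] := Hb n.
  by rewrite (lt_trans bm) // (le_lt_trans (um _ _ mn)).
have binj : injective b.
  by move=> m n E; case: (ltngtP m n) => // /bi; rewrite E ltxx.
have := @uniq_leq_size _ [seq b i | i <- iota 0 (size s).+1] s.
rewrite map_inj_uniq // iota_uniq size_map size_iota ltnn => H'.
suff: false by []; apply: (H' isT) => x /mapP[i _ ->]; by have [_] := Hb i.
Qed.

End FiniteSets.

Section IncreasingHomeos.
Variable R : realType.
Local Notation hR := (homeo R).
Implicit Types (f g v w : hR) (x y z a b s t d : R) (P A : set R).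

Definition increasing (f : R -> R) := forall x y, x < y -> f x < f y.

Lemma homeoME f g x : (f * g)%g x = f (g x). Proof. by []. Qed.
Lemma homeoVK f x : (f^-1)%g (f x) = x. Proof. exact: homeo_funK. Qed.
Lemma homeoKV f x : f ((f^-1)%g x) = x. Proof. exact: homeo_invK. Qed.

Lemma homeo_inj f : injective f. Proof. exact: can_inj (homeoVK f). Qed.

Lemma homeo_fixV f x : f x = x -> (f^-1)%g x = x.
Proof. by move=> fx; rewrite -{1}fx homeoVK. Qed.

Lemma commute_homeo f g x : commute f g -> f (g x) = g (f x).
Proof. by move=> fg; rewrite -!homeoME fg. Qed.

Lemma increasing_le f x y : increasing f -> x <= y -> f x <= f y.
Proof. by move=> fi; rewrite le_eqVlt => /orP[/eqP->//|/fi/ltW]. Qed.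

Lemma increasing_ltP f x y : increasing f -> f x < f y -> x < y.
Proof.
by move=> fi; have [yx|//] := leP y x; rewrite ltNge increasing_le.
Qed.

Lemma increasingV f : increasing f -> increasing (f^-1)%g.
Proof. by move=> fi x y xy; apply: (increasing_ltP fi); rewrite !homeoKV. Qed.

Lemma increasingM f g : increasing f -> increasing g -> increasing (f * g)%g.
Proof. by move=> fi gi x y xy; apply/fi/gi. Qed.

Lemma increasingX f n : increasing f -> increasing (f ^+ n)%g.
Proof.
by move=> fi; elim: n => // n IH; rewrite expgS; exact: increasingM.
Qed.

Lemma near_moved f x : f x <> x -> \forall y \near x, f y <> y.
Proof.
move=> fx.
have cf : {for x, continuous (fun y => f y - y)}.
  by apply: continuousB; [exact: homeo_continuous|exact: cvg_id].
have fx0 : f x - x != 0 by rewrite subr_eq0; apply/eqP.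
near=> y; move=> fy; have : f y - y != 0 by near: y; exact: cvgr_neq0 cf fx0.
by rewrite fy subrr eqxx.
Unshelve. all: by end_near.
Qed.

(** The left end of the component of [x] in the set moved by [f]. *)
Lemma last_fixed_point f a x : f a = a -> a < x -> f x <> x ->
  exists b, [/\ a <= b, b < x, f b = b & forall z, b < z <= x -> f z <> z].
Proof.
move=> fa ax fx; set S := [set z | a <= z <= x /\ f z = z].
have Sa : S a by split=> //; rewrite lexx ltW.
have Sx : ubound S x by move=> z [/andP[]].
have hS : has_sup S by split; [exists a | exists x].
have aS : a <= sup S by apply: ub_le_sup => //; exists x.
have Sxx : sup S <= x by apply: ge_sup => //; exists a.
have fS : f (sup S) = sup S.
  apply: contrapT => /near_moved/nearR[d d0 Hd].
  have [e [eax fe] eS] := sup_adherent d0 hS.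
  apply: (Hd e) => //.
  have : e <= sup S by apply: ub_le_sup => //; exists x.
  lra.
exists (sup S); split => //.
  by rewrite lt_neqAle Sxx andbT; apply/eqP => E; apply: fx; rewrite -E.
move=> z /andP[Sz zx] fz.
have : z <= sup S by apply: ub_le_sup; [exists x|split=> //; lra].
lra.
Qed.

Lemma iterate_fixed f x n : f x = x -> (f ^+ n)%g x = x.
Proof. by move=> fx; elim: n => // n IH; rewrite expgS homeoME IH. Qed.

(** The limit is the infimum of the orbit. *)
Lemma iterates_converge f a x : increasing f -> f a = a -> a < x -> f x < x ->
  exists y, [/\ a <= y, y < x, f y = y & forall d, 0 < d ->
    exists n0, forall n, (n0 <= n)%N -> y < (f ^+ n)%g x < y + d].
Proof.
move=> fi fa ax fx; set S := [set (f ^+ n)%g x | n in setT].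
have lS z : lbound S z <-> forall n, z <= (f ^+ n)%g x.
  by split=> [H n|H _ [n _ <-]//]; apply: H; exists n.
have Sa : lbound S a.
  by apply/lS => n; rewrite -(iterate_fixed n fa) increasing_le ?ltW//;
     exact: increasingX.
have hS : has_inf S by split; [exists x, 0%N | exists a].
have Sy : lbound S (inf S) by apply: inf_lbound; exists a.
have dec n : (f ^+ n.+1)%g x < (f ^+ n)%g x.
  by rewrite expgSr homeoME; apply: increasingX.
have mon m n : (m <= n)%N -> (f ^+ n)%g x <= (f ^+ m)%g x.
  elim: n => [|n IH]; first by rewrite leqn0 => /eqP->.
  rewrite leq_eqVlt => /orP[/eqP->//|/IH].
  by apply: le_trans; rewrite ltW.
have le_inf z : lbound S z -> z <= inf S.
  by move=> Sz; apply: lb_le_inf => //; exists x, 0%N.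
have fy : f (inf S) = inf S.
  apply/eqP; rewrite eq_le; apply/andP; split.
    apply: le_inf; apply/lS => n; rewrite (le_trans _ (ltW (dec n)))//.
    by rewrite expgS homeoME increasing_le//; exact: (lS _).1.
  rewrite -[leLHS](homeoKV f) increasing_le//; apply: le_inf; apply/lS => n.
  apply: contrapT => /negP; rewrite -ltNge => /fi.
  rewrite homeoKV -homeoME -expgS ltNge => /negP; apply; exact: (lS _).1.
exists (inf S); split => //.
- exact: le_inf.
- by have /lS/(_ 1%N) := Sy; rewrite expg1; lra.
- move=> d d0; have [_ [n0 _ <-] Hn] := inf_adherent d0 hS; exists n0 => n nn.
  rewrite (le_lt_trans (mon _ _ nn) Hn) andbT.
  by rewrite (le_lt_trans _ (dec n))//; exact: (lS _).1.
Qed.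

End IncreasingHomeos.

(** * Commuting piecewise linear homeomorphisms *)

Section PLHomeos.
Variable R : realType.
Local Notation hR := (homeo R).
Implicit Types (f g v w m : hR) (x y z a b c s t d : R) (P A : set R).
Local Notation PLh P := (@PL_homeos R R idfun P setT).

Lemma PL_increasing P f : PLh P f -> increasing f.
Proof. by case. Qed.

(** On the open interval this is the affine continuation of a germ; continuity
    extends it to the ends. *)
Lemma PL_affine P f l r : PLh P f -> l < r ->
  (forall x, l < x < r -> ~ breakpoints idfun f x) ->
  exists2 s, P s & forall x, l <= x <= r -> f x = f l + s * (x - l).
Proof.
move=> [_ _ Ps _] lr nb.
have slp x : l < x < r -> exists s, has_slope idfun f x s.
  by move=> /nb /contrapT.
set c := (l + r) / 2; have lcr : l < c < r by rewrite /c; lra.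
have [s sc] := slp c lcr.
have E x : l < x < r -> f x = f c + s * (x - c).
  move=> lxr; apply: affine_between sc => z; rewrite ge_min le_max => z1.
  by apply: slp; lra.
suff E' x : l <= x <= r -> f x = f c + s * (x - c).
  exists s; first exact: Ps sc.
  by move=> x lxr; rewrite (E' x) // (E' l) ?lexx ?ltW //; ring.
move=> lxr; apply: contrapT => nE.
pose k z := f z - (f c + s * (z - c)).
have ck : {for x, continuous k}.
  apply: continuousB; first exact: homeo_continuous.
  apply: continuousD; first exact: cst_continuous.
  apply: continuousM; first exact: cst_continuous.
  by apply: continuousB; [exact: cvg_id|exact: cst_continuous].
have kx0 : k x != 0 by rewrite /k subr_eq0; apply/eqP.
have [d d0 Hd] := (nearR _ _).1 (cvgr_neq0 _ ck kx0).
have [z [xz zx lzr]] : exists z, [/\ x - d < z, z < x + d & l < z < r].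
  have [xc|cx] := leP x c.
  - exists (Num.min (x + d / 2) c).
    by split; rewrite ?gt_min ?lt_min; lra.
  - exists (Num.max (x - d / 2) c).
    by split; rewrite ?lt_max ?gt_max; lra.
by have := Hd z xz zx; rewrite /k E // subrr eqxx.
Qed.

Lemma PL_right_affine P f a : PLh P f ->
  exists s d, [/\ P s, 0 < d &
    forall x, a <= x <= a + d -> f x = f a + s * (x - a)].
Proof.
move=> Pf; have [_ fin _ _] := Pf.
have [d d0 Hd] := finite_right_gap a fin.
have [s Ps Hs] := PL_affine Pf (ltac:(lra) : a < a + d) Hd.
by exists s, d.
Qed.

(** The point [a] is included, so that [f] fixes it: these are the right germs
    of the stabilizer of [a], and their slopes multiply. *)
Definition right_slope (f : R -> R) a s :=
  exists2 d, 0 < d & forall x, a <= x <= a + d -> f x = a + s * (x - a).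

Lemma right_slope_fix f a s : right_slope f a s -> f a = a.
Proof. by move=> [d d0 ->]; [rewrite subrr mulr0 addr0|lra]. Qed.

Lemma PL_right_slope P f a : PLh P f -> f a = a ->
  exists2 s, P s & right_slope f a s.
Proof.
move=> Pf fa; have [s [d [Ps d0]]] := PL_right_affine a Pf.
by rewrite fa => Hd; exists s => //; exists d.
Qed.

Lemma right_slope_uniq f a s t : right_slope f a s -> right_slope f a t -> s = t.
Proof.
move=> [d d0 Hd] [e e0 He].
have [m m0 [md me]] : exists2 m, 0 < m & m <= d /\ m <= e.
  by exists (Num.min d e); rewrite ?lt_min ?d0 // !ge_min !lexx orbT.
have E1 := Hd (a + m) ltac:(lra); have E2 := He (a + m) ltac:(lra).
have m0' : m != 0 by rewrite gt_eqF.
by apply: (mulIf m0'); lra.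
Qed.

Lemma right_slope_gt0 f a s : increasing f -> right_slope f a s -> 0 < s.
Proof.
move=> fi fs; have fa := right_slope_fix fs; case: fs => d d0 Hd.
have := fi a (a + d) ltac:(lra); rewrite fa Hd; last lra.
by rewrite ltrDl (_ : a + d - a = d) ?pmulr_lgt0 //; ring.
Qed.

Lemma right_slopeM f g a s t : increasing g ->
  right_slope f a s -> right_slope g a t -> right_slope (f * g)%g a (s * t).
Proof.
move=> gi fs gt_; have t0 := right_slope_gt0 gi gt_.
case: fs gt_ => d d0 Hd [e e0 He].
have [m m0 [me mt]] : exists2 m, 0 < m & m <= e /\ t * m <= d.
  exists (Num.min e (d / t)); first by rewrite lt_min e0 divr_gt0.
  split; first by rewrite ge_min lexx.
  by rewrite mulrC -ler_pdivlMr // ge_min lexx orbT.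
exists m => // x axm; rewrite homeoME He; last lra.
have : 0 <= t * (x - a) <= t * m.
  apply/andP; split; first by apply: mulr_ge0; [exact: ltW|lra].
  by rewrite ler_pM2l //; lra.
by move=> txa; rewrite Hd; [ring|lra].
Qed.

Lemma right_slopeV f a s : increasing f ->
  right_slope f a s -> right_slope (f^-1)%g a s^-1.
Proof.
move=> fi fs; have s0 := right_slope_gt0 fi fs; case: fs => d d0 Hd.
exists (s * d); first exact: mulr_gt0.
move=> x axd; apply: (@homeo_inj _ f); rewrite homeoKV Hd.
  by rewrite addrAC subrr add0r mulVKf ?gt_eqF// addrC subrK.
rewrite lerDl lerD2l; apply/andP; split.
  by apply: mulr_ge0; [rewrite invr_ge0 ltW|lra].
by rewrite mulrC ler_pdivrMr // mulrC; lra.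
Qed.

Lemma right_slope1 a : right_slope (1 : hR)%g a 1.
Proof. by exists 1 => // x _ /=; ring. Qed.

Lemma commgE (gT : groupType) (g h : gT) : [~ g, h]%g = ((h * g)^-1 * (g * h))%g.
Proof. by rewrite /commg /conjg invgM !mulgA. Qed.

(** Slopes are multiplicative and positive numbers commute. *)
Lemma right_slopeR f g a s t : increasing f -> increasing g ->
  right_slope f a s -> right_slope g a t -> right_slope [~ f, g]%g a 1.
Proof.
move=> fi gi fs gt_; rewrite commgE.
have fg := right_slopeM gi fs gt_; have gf := right_slopeM fi gt_ fs.
have t0 := right_slope_gt0 gi gt_; have s0 := right_slope_gt0 fi fs.
rewrite -(@mulVf _ (t * s)) ?mulf_neq0 ?gt_eqF// [X in _ * X]mulrC.
apply: right_slopeM => //; first exact: increasingM.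
by apply: right_slopeV => //; exact: increasingM.
Qed.

(** If [v] and [f] commute and [f] moves a fixed point [x] of [v], then [v]
    fixes the whole orbit of [x] under [f].  As [v] has finitely many
    breakpoints it is affine, hence trivial, between two consecutive points of
    this orbit, and commutation carries this back to [x]. *)
Lemma fix_up_to_image P v f x : PLh P v -> increasing f -> commute v f ->
  v x = x -> x < f x -> forall z, x <= z <= f x -> v z = z.
Proof.
move=> Pv fi vf vx xfx z xz.
pose u n := (f ^+ n)%g x.
have cn n : commute v (f ^+ n)%g by exact: commuteX.
have ui n : u n < u n.+1.
  by rewrite /u expgSr homeoME; apply: increasingX.
have vu n : v (u n) = u n by rewrite /u commute_homeo // vx.
have [_ fin _ _] := Pv.
have [n Hn] := finite_pigeonhole fin ui.
have [s Ps Hs] := PL_affine Pv (ui n) Hn.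
have s1 : s = 1.
  have := Hs (u n.+1); rewrite !vu lexx ltW //= => /(_ isT) E.
  have u0 : u n.+1 - u n != 0 by rewrite gt_eqF // subr_gt0.
  by apply: (mulIf u0); lra.
apply: (@homeo_inj _ (f ^+ n)%g); rewrite -commute_homeo // Hs.
  by rewrite vu s1; ring.
have fni : increasing (f ^+ n)%g by exact: increasingX.
by case/andP: xz => xz zx; rewrite /u expgSr homeoME !increasing_le.
Qed.

(** The previous lemma, used on both sides of [x]. *)
Lemma fix_near_moved P v f x : PLh P v -> increasing f -> commute v f ->
  v x = x -> f x <> x -> \forall z \near x, v z = z.
Proof.
move=> Pv.
have key g : increasing g -> commute v g -> v x = x -> x < g x ->
    \forall z \near x, v z = z.
  move=> gi vg vx xgx; apply/nearR.
  have gix : (g^-1)%g x < x by rewrite -[ltRHS](homeoVK g); apply: (increasingV gi).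
  have vgi : v ((g^-1)%g x) = (g^-1)%g x.
    by rewrite commute_homeo ?vx//; exact: commuteV.
  exists (Num.min (g x - x) (x - (g^-1)%g x)); first by rewrite lt_min; lra.
  move=> z; have [xz|zx] := leP x z.
    move=> _; rewrite -ltrBlDl lt_min => /andP[zg _].
    by apply: (fix_up_to_image Pv gi vg vx xgx); lra.
  rewrite ltrBlDl -ltrBlDr lt_min => /andP[_ zg] _.
  by apply: (fix_up_to_image Pv gi vg vgi); rewrite homeoKV //; lra.
move=> fi vf vx fx; have [xfx|fxx|E] := ltgtP x (f x); last by case: fx.
  exact: (key f).
apply: (key (f^-1)%g) => //; [exact: increasingV|exact: commuteV|].
by rewrite -[ltLHS](homeoVK f); apply: (increasingV fi).
Qed.

(** If [w] moved all points of [a, x], the fixed points of [v] would form an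
    open and closed subset of this segment, by the previous lemma. *)
Lemma commute_fixed_point P v w a x : PLh P v -> increasing w -> commute v w ->
  v a = a -> v x <> x -> a <= x -> exists2 z, a <= z <= x & w z = z.
Proof.
move=> Pv wi vw va vx ax; apply: contrapT => nw; apply: vx.
apply: (@segment_clopen_ind _ (fun z => v z = z) a x) => //; last by rewrite ax lexx.
- move=> z azx vz; apply: (fix_near_moved Pv wi vw vz) => wz.
  by apply: nw; exists z.
- by move=> z _; exact: near_moved.
Qed.

(** Let ]a, z] be the left part of a component of the set moved by [v], and
    suppose that [g] maps some point of it into it.  As [v] commutes with its
    conjugate by [g], both move the same component, and [g] fixes its end [a].
    The conjugates by [g] of [m1] and [m2] commute with [v] and so fix [a] too;
    hence [m1] and [m2] fix [a].  Slopes at [a] being multiplicative, the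
    commutator [v] has slope 1 there, a contradiction. *)
Lemma commutator_wanders P Q g m1 m2 (v := [~ m1, m2]%g) a x z :
  PLh P v -> PLh P (v ^ g^-1)%g -> increasing g -> PLh Q m1 -> PLh Q m2 ->
  commute v (v ^ g^-1)%g -> commute v (m1 ^ g^-1)%g -> commute v (m2 ^ g^-1)%g ->
  v a = a -> (forall y, a < y <= z -> v y <> y) ->
  a < x <= z -> ~ (a < g x <= z).
Proof.
move=> Pv Pv2 gi Q1 Q2 vv2 vm1 vm2 va mv axz agxz.
have cE f y : (f ^ g^-1)%g (g y) = g (f y) by rewrite /conjg !homeoME homeoVK invgK.
have az : a < z by lra.
have not_near y : a <= y < z -> ~ \forall u \near y, v u = u.
  move=> ayz /nearR[d d0 Hd].
  have [u [yu uy uz]] : exists u, [/\ y < u, u < y + d & u <= z].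
    by exists (Num.min (y + d / 2) z); split; rewrite ?lt_min ?gt_min ?ge_min ?lexx ?orbT//; lra.
  by apply: (mv u); [lra|apply: Hd => //; lra].
have ci f : increasing f -> increasing (f ^ g^-1)%g.
  move=> fi; rewrite /conjg; apply: increasingM; first exact/increasingV/increasingV.
  by apply: increasingM => //; exact: increasingV.
have vi := PL_increasing Pv.
have ga : g a = a.
  have [aga|gaa|//] := ltgtP a (g a).
    have v2ga : (v ^ g^-1)%g (g a) = g a by rewrite cE va.
    have gax : g a < g x by apply: gi; lra.
    have vga : v (g a) <> g a by apply: mv; lra.
    have := fix_near_moved Pv2 vi (commute_sym vv2) v2ga vga.
    move=> /nearR[d d0 Hd].
    have E u : g a < u < g a + d -> v ((g^-1)%g u) = (g^-1)%g u.
      move=> uga; apply: (@homeo_inj _ g); rewrite -cE homeoKV.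
      by apply: Hd; lra.
    pose u := Num.min (g a + d / 2) (g x).
    have uE : g a < u < g a + d /\ u <= g x.
      by rewrite /u lt_min gt_min ge_min lexx orbT; split=> //; lra.
    case: uE => ugad ugx; exfalso; apply: (mv ((g^-1)%g u)) (E u ugad).
    rewrite -{1}(homeoVK g a) (increasingV gi) ?andTb; last lra.
    by have /(increasing_le (increasingV gi)) := ugx; rewrite homeoVK => ?; lra.
  have ia : a < (g^-1)%g a by rewrite -[ltLHS](homeoVK g); apply: (increasingV gi).
  have iax : (g^-1)%g a < x by apply: (increasing_ltP gi); rewrite homeoKV; lra.
  have v2a : (v ^ g^-1)%g a <> a.
    rewrite -{1 2}(homeoKV g a) cE => /homeo_inj; apply: mv; lra.
  exfalso; apply: (not_near a); first lra.
  exact: (fix_near_moved Pv (ci _ vi) vv2 va v2a).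
have fixm m : increasing m -> commute v (m ^ g^-1)%g -> m a = a.
  move=> mi vm; apply: contrapT => ma; apply: (not_near a); first lra.
  apply: (fix_near_moved Pv (ci _ mi) vm va).
  by rewrite -{1 2}ga cE => /homeo_inj.
have m1i := PL_increasing Q1; have m2i := PL_increasing Q2.
have [s1 _ S1] := PL_right_slope Q1 (fixm _ m1i vm1).
have [s2 _ S2] := PL_right_slope Q2 (fixm _ m2i vm2).
have [d d0 Hd] := right_slopeR m1i m2i S1 S2.
have [u [au ud uz]] : exists u, [/\ a < u, u <= a + d & u <= z].
  by exists (Num.min (a + d) z); split; rewrite ?lt_min ?ge_min ?lexx ?orbT//; lra.
by apply: (mv u); [lra|rewrite Hd ?mul1r; lra].
Qed.

End PLHomeos.

(** * Groups of slopes and modules of breakpoints *)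

Section Scalars.
Variable R : realType.
Implicit Types (P A : set R) (x y s t : R).

Lemma in_setP A x : x \in A <-> A x.
Proof. by rewrite in_setE. Qed.

Lemma pos_subgroup_gt0 P s : pos_subgroup P -> P s -> 0 < s.
Proof. by move=> [P0 _] /P0. Qed.

Lemma pos_subgroup1 P : pos_subgroup P -> P 1.
Proof. by move=> [_ [/in_setP]]. Qed.

Lemma pos_subgroup_div P s t : pos_subgroup P -> P s -> P t -> P (s / t).
Proof.
by move=> [_ [_ PD]] /in_setP Ps /in_setP Pt; apply/in_setP; exact: PD.
Qed.

Lemma pos_subgroupV P s : pos_subgroup P -> P s -> P s^-1.
Proof.
by move=> Pg Ps; rewrite -div1r; apply: pos_subgroup_div => //; exact: pos_subgroup1.
Qed.

Lemma pos_subgroupM P s t : pos_subgroup P -> P s -> P t -> P (s * t).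
Proof.
by move=> Pg Ps Pt; rewrite -(invrK t); apply: pos_subgroup_div => //; exact: pos_subgroupV.
Qed.

Lemma pos_subgroupX P s n : pos_subgroup P -> P s -> P (s ^+ n).
Proof.
move=> Pg Ps; elim: n => [|n IH]; first by rewrite expr0; exact: pos_subgroup1.
by rewrite exprS; exact: pos_subgroupM.
Qed.

Lemma submodule_sub P A x y : is_submodule P A -> A x -> A y -> A (x - y).
Proof.
by move=> [[_ AB] _] /in_setP Ax /in_setP Ay; apply/in_setP; exact: AB.
Qed.

Lemma submodule0 P A : is_submodule P A -> A 0.
Proof. by move=> [[/in_setP]]. Qed.

Lemma submoduleN P A x : is_submodule P A -> A x -> A (- x).
Proof.
by move=> Am Ax; rewrite -sub0r; apply: (submodule_sub Am) => //; exact: (submodule0 Am).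
Qed.

Lemma submoduleD P A x y : is_submodule P A -> A x -> A y -> A (x + y).
Proof.
by move=> Am Ax Ay; rewrite -(opprK y); apply: (submodule_sub Am) => //; exact: (submoduleN Am).
Qed.

Lemma submoduleZ P A s x : is_submodule P A -> P s -> A x -> A (s * x).
Proof. by move=> [_ AZ] Ps; apply: AZ; exact: sub_gen_smallest. Qed.

Lemma submoduleMn P A x n : is_submodule P A -> A x -> A (x *+ n).
Proof.
move=> Am Ax; elim: n => [|n IH]; first by rewrite mulr0n; exact: (submodule0 Am).
by rewrite mulrS; exact: (submoduleD Am).
Qed.

(** Multiplication by powers of a slope less than 1 makes elements of [A]
    arbitrarily small, and [A] contains their integer multiples. *)
Lemma submodule_dense P A s x0 : pos_subgroup P -> is_submodule P A ->
  P s -> s < 1 -> A x0 -> x0 != 0 ->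
  forall l r, l < r -> exists2 x, A x & l < x < r.
Proof.
move=> Pg Am Ps s1 Ax0 x00 l r lr.
have s0 := pos_subgroup_gt0 Pg Ps.
have [y Ay y0] : exists2 y, A y & 0 < y.
  have [x0p|x0n|x0E] := ltgtP 0 x0; first by exists x0.
  - by exists (- x0); [exact: (submoduleN Am)|rewrite oppr_gt0].
  - by rewrite -x0E eqxx in x00.
have [b Ab [b0 blr]] : exists2 b, A b & 0 < b /\ b < r - l.
  have ns : `|s| < 1 by rewrite gtr0_norm.
  have e0 : 0 < (r - l) / y by rewrite divr_gt0 // subr_gt0.
  have [n _ /(_ n (leqnn n)) Hn] := cvgr_lt _ (cvg_expr ns) _ e0.
  exists (s ^+ n * y); first by apply: (submoduleZ Am) => //; exact: pos_subgroupX.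
  by split; [rewrite mulr_gt0 // exprn_gt0|rewrite -ltr_pdivlMr].
pose k := Num.floor (l / b) + 1.
have /andP[k1 k2] := floor_itv (l / b).
exists (b *~ k).
  case: (k) => n; first exact: (submoduleMn _ Am).
  by rewrite NegzE mulrNz; apply: (submoduleN Am); exact: (submoduleMn _ Am).
rewrite -mulrzr mulrC /k.
have bN : b != 0 by rewrite gt_eqF.
have lE : l = l / b * b by rewrite divfK.
rewrite {1}lE ltr_pM2r // k2 /=.
rewrite intrD mulrDl mul1r.
have : (Num.floor (l / b))%:~R * b <= l by rewrite -ler_pdivlMr.
lra.
Qed.

End Scalars.

(** * Reflection and behaviour at infinity *)

Section Reflection.
Variable R : realType.
Local Notation hR := (homeo R).
Implicit Types (f g : hR) (x y a b s t d : R) (P A I : set R).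

Lemma reflect_continuous (f : R -> R) : continuous f -> continuous (fun x => - f (- x)).
Proof.
move=> cf x; apply: continuousN; apply: (@continuous_comp _ _ _ (fun x => - x) f).
  exact: opp_continuous.
exact: cf.
Qed.

Lemma reflectK f : cancel (fun x => - f (- x)) (fun x => - (f^-1)%g (- x)).
Proof. by move=> x; rewrite opprK homeoVK opprK. Qed.

Lemma reflectVK f : cancel (fun x => - (f^-1)%g (- x)) (fun x => - f (- x)).
Proof. by move=> x; rewrite opprK homeoKV opprK. Qed.

(** This automorphism exchanges the two sides of points, so that one-sided
    arguments can be made on the right only. *)
Definition reflect_homeo f : hR :=
  Homeo (reflectK f) (reflectVK f)
    (reflect_continuous (@homeo_continuous _ f))
    (reflect_continuous (@homeo_continuous _ (f^-1)%g)).

Lemma reflect_homeoE f x : reflect_homeo f x = - f (- x). Proof. by []. Qed.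

Lemma reflect_homeoK : involutive reflect_homeo.
Proof. by move=> f; apply: homeo_ext => x; rewrite !reflect_homeoE !opprK. Qed.

Lemma reflect_homeoM f g : reflect_homeo (f * g)%g = (reflect_homeo f * reflect_homeo g)%g.
Proof.
by apply: homeo_ext => x; rewrite !(reflect_homeoE, homeoME) opprK.
Qed.

Lemma reflect_homeoV f : reflect_homeo (f^-1)%g = ((reflect_homeo f)^-1)%g.
Proof. exact: homeo_ext. Qed.

Lemma reflect_has_slope f x s :
  has_slope idfun (reflect_homeo f) x s <-> has_slope idfun f (- x) s.
Proof.
split=> /has_slopeP[d d0 Hd]; apply/has_slopeP; exists d => // y y1 y2.
- have := Hd (- y) ltac:(lra) ltac:(lra).
  by rewrite !reflect_homeoE opprK => E; lra.
- have := Hd (- y) ltac:(lra) ltac:(lra).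
  by rewrite !reflect_homeoE => E; lra.
Qed.

Lemma reflect_breakpoints f x :
  breakpoints idfun (reflect_homeo f) x <-> breakpoints idfun f (- x).
Proof.
by split=> + [s fs]; apply; exists s; apply/reflect_has_slope.
Qed.

Lemma reflect_PL P B f : PL_homeos idfun P B f -> (forall x, B x -> B (- x)) ->
  PL_homeos idfun P B (reflect_homeo f).
Proof.
move=> [fi fin Ps BB] BN; split.
- by move=> x y xy; rewrite /= ltrN2; apply: fi; rewrite /= ltrN2.
- have -> : breakpoints idfun (reflect_homeo f) = -%R @` breakpoints idfun f.
    apply/seteqP; split=> x.
      by move=> /reflect_breakpoints fx; exists (- x); rewrite ?opprK.
    by move=> [y fy <-]; apply/reflect_breakpoints; rewrite opprK.
  exact: finite_image.
- by move=> x s /reflect_has_slope; exact: Ps.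
- move=> _ [x /reflect_breakpoints fx <-] /=; rewrite -(opprK x); apply: BN.
  by apply: BB; exists (- x).
Qed.

End Reflection.

Section Germs.
Variable R : realType.
Local Notation hR := (homeo R).
Implicit Types (f g : hR) (x y a b c s t d : R) (P A I : set R).
Local Notation PLh P := (@PL_homeos R R idfun P setT).

Lemma finite_lower_gap (B : set R) : finite_set B ->
  exists M, forall x, x <= M -> ~ B x.
Proof.
move=> /(finite_image -%R)/finite_upper_gap[M HM]; exists (- M) => x xM Bx.
by apply: (HM (- x)); [lra|exists x].
Qed.

Definition affine_at_minus_infty (f : R -> R) s c :=
  exists M, forall x, x <= M -> f x = s * x + c.

Lemma PL_affine_at_minus_infty P f : PLh P f ->
  exists s c, 0 < s /\ affine_at_minus_infty f s c.
Proof.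
move=> [fi fin Ps _]; have [M HM] := finite_lower_gap fin.
have slp x : x <= M -> exists s, has_slope idfun f x s by move=> /HM/contrapT.
have [s sM] := slp M (lexx M).
have E x : x <= M -> f x = s * x + (f M - s * M).
  move=> xM; rewrite (affine_between (x := M) (y := x) _ sM); first by ring.
  by move=> z; rewrite min_r ?max_l // => zM; apply: slp; lra.
exists s, (f M - s * M); split; last by exists M.
have := fi (M - 1) M ltac:(rewrite /=; lra).
by rewrite /= E; last lra; lra.
Qed.

Lemma affine_at_minus_inftyM f g s c t d : 0 < t ->
  affine_at_minus_infty f s c -> affine_at_minus_infty g t d ->
  affine_at_minus_infty (f * g)%g (s * t) (s * d + c).
Proof.
move=> t0 [M HM] [N HN]; exists (Num.min N ((M - d) / t)) => x.
rewrite le_min => /andP[xN xM]; rewrite homeoME HN // HM; first ring.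
by move: xM; rewrite ler_pdivlMr //; lra.
Qed.

(** Both products have slope [s * t], so they differ by a translation. *)
Lemma affine_at_minus_inftyR f g s c t d : 0 < s -> 0 < t ->
  affine_at_minus_infty f s c -> affine_at_minus_infty g t d ->
  affine_at_minus_infty [~ f, g]%g 1 ((s * d + c - (t * c + d)) / (t * s)).
Proof.
move=> s0 t0 fs gt_; rewrite commgE.
have [M HM] := affine_at_minus_inftyM t0 fs gt_.
have [N HN] := affine_at_minus_inftyM s0 gt_ fs.
set e := _ / _; exists (Num.min M (N - e)) => x.
rewrite le_min => /andP[xM xN]; rewrite homeoME HM //.
have ts : t * s != 0 by rewrite mulf_neq0 ?gt_eqF.
rewrite (_ : _ + _ = (g * f)%g (1 * x + e)) ?homeoVK // HN; last lra.
by rewrite /e mulrDr [_ * (_ / _)]mulrC divfK // mul1r; ring.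
Qed.

(** Commutators of piecewise affine maps are translations near the ends of the
    line, and translations commute. *)
Lemma double_commutator_fixes_below P f1 f2 f3 f4 :
  PLh P f1 -> PLh P f2 -> PLh P f3 -> PLh P f4 ->
  exists M, forall x, x <= M -> [~ [~ f1, f2], [~ f3, f4]]%g x = x.
Proof.
move=> /PL_affine_at_minus_infty[s1 [c1 [s10 H1]]].
move=> /PL_affine_at_minus_infty[s2 [c2 [s20 H2]]].
move=> /PL_affine_at_minus_infty[s3 [c3 [s30 H3]]].
move=> /PL_affine_at_minus_infty[s4 [c4 [s40 H4]]].
have := affine_at_minus_inftyR ltr01 ltr01
  (affine_at_minus_inftyR s10 s20 H1 H2) (affine_at_minus_inftyR s30 s40 H3 H4).
move=> [M HM]; exists M => x /HM ->; rewrite !mul1r.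
by rewrite [X in (X - _)]addrC subrr mul0r addr0.
Qed.

End Germs.

(** * Bieri-Strebel groups *)

Section BieriStrebelGroups.
Variable R : realType.
Local Notation hR := (homeo R).
Implicit Types (f g : hR) (x y a b c s t d : R) (P A I : set R).

Lemma has_slope_gt0 f x s : increasing f -> has_slope idfun f x s -> 0 < s.
Proof.
move=> fi /has_slopeP[d d0 Hd].
have := fi x (x + d / 2) ltac:(lra); rewrite (Hd (x + d / 2)); try lra.
have -> : x + d / 2 - x = d / 2 by ring.
by rewrite ltrDl pmulr_lgt0 // divr_gt0.
Qed.

Lemma has_slopeV f x s : increasing f ->
  has_slope idfun f x s -> has_slope idfun (f^-1)%g (f x) s^-1.
Proof.
move=> fi fs; have s0 := has_slope_gt0 fi fs.
have cV : (f^-1)%g z @[z --> f x] --> x.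
  by rewrite -[X in _ --> X](homeoVK f); exact: homeo_continuous.
rewrite /has_slope homeoVK; near=> y.
have E : f ((f^-1)%g y) = f x + s * ((f^-1)%g y - x) by near: y; exact: (cV _ fs).
rewrite homeoKV in E.
have -> : idfun y - idfun (f x) = s * ((f^-1)%g y - x) by rewrite {1}E /=; ring.
by rewrite mulKf ?gt_eqF // addrC subrK.
Unshelve. all: by end_near.
Qed.

Lemma breakpointsM f g x : breakpoints idfun (f * g)%g x ->
  breakpoints idfun g x \/ breakpoints idfun f (g x).
Proof.
move=> fg; apply: contrapT => /not_orP[/contrapT[s gs] /contrapT[t ft]].
apply: fg; exists (t * s); apply: has_slope_comp gs ft.
exact: homeo_continuous.
Qed.

Lemma breakpointsV f x : increasing f ->
  breakpoints idfun (f^-1)%g x -> breakpoints idfun f ((f^-1)%g x).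
Proof.
move=> fi + [s fs]; apply; exists s^-1.
by rewrite -[X in has_slope _ _ X](homeoKV f); exact: has_slopeV.
Qed.

Lemma BieriStrebelP I A P f : BieriStrebel I A P f <->
  [/\ PL_homeos idfun P A f, forall x, ~ I x -> f x = x & f @` A = A].
Proof.
split=> [[Pf [fI fA]]|[Pf fI fA]]; split => //.
  by move=> x; apply: contra_notP => fx; apply: fI; apply/eqP.
by split=> // x /= /eqP; apply: contra_notP => nI; exact: fI.
Qed.

Lemma BieriStrebel_PL I A P f : BieriStrebel I A P f -> PL_homeos idfun P setT f.
Proof. by move=> [[? ? ? ?] _]; split. Qed.

Lemma BieriStrebel_increasing I A P f : BieriStrebel I A P f -> increasing f.
Proof. by move=> /BieriStrebel_PL/PL_increasing. Qed.

Lemma BieriStrebel_sub I J A P f : I `<=` J ->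
  BieriStrebel I A P f -> BieriStrebel J A P f.
Proof.
move=> IJ /BieriStrebelP[Pf fI fA]; apply/BieriStrebelP; split=> // x nJ.
by apply: fI => /IJ.
Qed.

Lemma BieriStrebel_support I J A P f : (forall x, ~ J x -> f x = x) ->
  BieriStrebel I A P f -> BieriStrebel J A P f.
Proof. by move=> fJ /BieriStrebelP[Pf fI fA]; apply/BieriStrebelP. Qed.

Lemma BieriStrebel1 I A P : pos_subgroup P -> BieriStrebel I A P 1%g.
Proof.
move=> Pg.
have sl1 x : has_slope idfun (1%g : hR) x 1 by near=> y => /=; ring.
have nb x : ~ breakpoints idfun (1%g : hR) x by apply; exists 1.
apply/BieriStrebelP; split=> //; last first.
  by apply/seteqP; split=> [_ [y ? <-//]|y ?]; exists y.
split=> //.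
- rewrite (_ : breakpoints _ _ = set0) //.
  by apply/seteqP; split=> // x /nb.
- by move=> x s xs; rewrite (has_slope_uniq xs (sl1 x)); exact: pos_subgroup1.
- by move=> y [x /nb].
Unshelve. all: by end_near.
Qed.

(** At a breakpoint of one factor the composite may have a slope; this slope
    is the one at nearby points, where the chain rule applies. *)
Lemma BieriStrebelM I A P f g : pos_subgroup P ->
  BieriStrebel I A P f -> BieriStrebel I A P g -> BieriStrebel I A P (f * g)%g.
Proof.
move=> Pg /BieriStrebelP[[fi ffin fP fB] fI fA] /BieriStrebelP[[gi gfin gP gB] gI gA].
have gVA x : A (g x) -> A x by rewrite -{1}gA => -[y Ay] /homeo_inj <-.
set B := breakpoints idfun g `|` (g^-1)%g @` breakpoints idfun f.
have Bfin : finite_set B by rewrite finite_setU; split=> //; exact: finite_image.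
have fgB x : breakpoints idfun (f * g)%g x -> B x.
  move=> /breakpointsM[]; first by left.
  by move=> fx; right; exists (g x); rewrite ?homeoVK.
apply/BieriStrebelP; split; first split.
- exact: increasingM.
- exact: sub_finite_set Bfin.
- move=> x s /has_slope_near/nearR[d d0 Hd].
  have [e e0 He] := finite_right_gap x Bfin.
  have [y [xy yd ye]] : exists y, [/\ x < y, y < x + d & y < x + e].
    by exists (x + Num.min d e / 2); rewrite !ltrD2l ltrDl divr_gt0 ?lt_min ?d0//;
       split=> //; rewrite ltr_pdivrMr // gt_min; apply/orP; lra.
  have /not_orP[/contrapT[t gt_] nf] : ~ B y by apply: He; lra.
  have [u fu] : exists u, has_slope idfun f (g y) u.
    by apply: contrapT => fgy; apply: nf; exists (g y); rewrite ?homeoVK.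
  have fgs : has_slope idfun (f * g)%g y (u * t).
    by apply: has_slope_comp gt_ fu; exact: homeo_continuous.
  have -> : s = u * t by apply: has_slope_uniq fgs; apply: Hd; lra.
  by apply: pos_subgroupM => //; [exact: fP fu|exact: gP gt_].
- move=> _ [x /breakpointsM[gx|fx] <-]; first by apply: gB; exists x.
  by apply: gVA; apply: fB; exists (g x).
- by move=> x nI; rewrite homeoME gI // fI.
- by rewrite -[RHS]fA -[in RHS]gA -image_comp.
Qed.

Lemma BieriStrebelV I A P f : pos_subgroup P ->
  BieriStrebel I A P f -> BieriStrebel I A P (f^-1)%g.
Proof.
move=> Pg /BieriStrebelP[[fi ffin fP fB] fI fA].
have fVA x : A x -> A ((f^-1)%g x) by rewrite -{1}fA => -[y Ay <-]; rewrite homeoVK.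
have vi : increasing (f^-1)%g by exact: increasingV.
have bE x : breakpoints idfun (f^-1)%g x -> (f @` breakpoints idfun f) x.
  by move=> /(breakpointsV fi) bx; exists ((f^-1)%g x); rewrite ?homeoKV.
apply/BieriStrebelP; split; first split.
- exact: vi.
- exact: (sub_finite_set bE (finite_image _ ffin)).
- move=> x s fs; have := has_slopeV vi fs; rewrite invgK => /fP.
  by move=> /(pos_subgroupV Pg); rewrite invrK.
- move=> _ [x /bE[y fy <-] <-] /=; rewrite -fA; exists y => //.
  by apply: fB; exists y.
- by move=> x nI; apply: homeo_fixV; exact: fI.
- apply/seteqP; split=> [_ [x Ax <-]|x Ax]; first exact: fVA.
  by exists (f x); rewrite ?homeoVK // -fA; exists x.
Qed.

Lemma BieriStrebelX I A P f n : pos_subgroup P ->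
  BieriStrebel I A P f -> BieriStrebel I A P (f ^+ n)%g.
Proof.
move=> Pg If; elim: n => [|n IH]; first exact: BieriStrebel1.
by rewrite expgS; exact: BieriStrebelM.
Qed.

Lemma BieriStrebelR I A P f g : pos_subgroup P ->
  BieriStrebel I A P f -> BieriStrebel I A P g -> BieriStrebel I A P [~ f, g]%g.
Proof.
move=> Pg If Ig; rewrite commgE; apply: BieriStrebelM => //; last exact: BieriStrebelM.
by apply: BieriStrebelV => //; exact: BieriStrebelM.
Qed.

Lemma reflect_BieriStrebel a b A P f : (forall x, A x -> A (- x)) ->
  BieriStrebel `[a, b]%classic A P f ->
  BieriStrebel `[- b, - a]%classic A P (reflect_homeo f).
Proof.
move=> AN /BieriStrebelP[Pf fI fA]; apply/BieriStrebelP; split.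
- exact: reflect_PL.
- move=> x; rewrite /= in_itv /= => nI; rewrite fI ?opprK //=.
  by rewrite in_itv /= => xI; apply: nI; lra.
- have sub g : (forall x, A x -> A (g x)) -> forall x, A x -> A (reflect_homeo g x).
    by move=> gA x Ax; rewrite reflect_homeoE; apply/AN/gA/AN.
  have fA' x : A x -> A (f x) by move=> Ax; rewrite -fA; exists x.
  have fVA' x : A x -> A ((f^-1)%g x) by rewrite -{1}fA => -[y Ay <-]; rewrite homeoVK.
  apply/seteqP; split=> [_ [x Ax <-]|x Ax]; first exact: sub.
  exists (reflect_homeo (f^-1)%g x); first exact: sub.
  by rewrite reflect_homeoV homeoKV.
Qed.

Lemma disjoint_supports_commute f g (I J : set R) :
  (forall x, ~ I x -> f x = x) -> (forall x, ~ J x -> g x = x) ->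
  (forall x, I x -> ~ J x) -> commute f g.
Proof.
move=> fI gJ IJ; apply: homeo_ext => x; rewrite !homeoME.
have [fx|fx] := eqVneq (f x) x.
  have [gx|gx] := eqVneq (g x) x; first by rewrite gx fx gx.
  rewrite fx fI // => Igx; move/eqP: gx; apply.
  by apply: (@homeo_inj _ g); apply: gJ; exact: IJ.
have Ix : I x by apply: contrapT => nI; move/eqP: fx; apply; exact: fI.
have If : I (f x).
  apply: contrapT => nI; move/eqP: fx; apply; apply: (@homeo_inj _ f); exact: fI.
by rewrite !gJ //; exact: IJ.
Qed.

End BieriStrebelGroups.

(** * Elements with prescribed slopes *)

Section Bends.
Variable R : realType.
Local Notation hR := (homeo R).
Implicit Types (f g : R -> R) (x y a b c s t d : R) (P A I : set R).

Lemma increasing_bijection_continuous f g : increasing f ->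
  cancel f g -> cancel g f -> continuous f.
Proof.
move=> fi fK gK x B /nearR[d d0 Hd]; apply/nearR.
have ltP u v : f u < f v -> u < v.
  by move=> fuv; rewrite ltNge le_eqVlt; apply/negP => /orP[/eqP E|/fi]; 
     [move: fuv; rewrite E ltxx|move: fuv; lra].
have l1 : g (f x - d) < x by apply: ltP; rewrite gK; lra.
have l2 : x < g (f x + d) by apply: ltP; rewrite gK; lra.
exists (Num.min (x - g (f x - d)) (g (f x + d) - x)); first by rewrite lt_min; lra.
move=> y y1 y2; apply: Hd.
  rewrite -(gK (f x - d)); apply: fi.
  by move: y1; rewrite ltrBlDl -ltrBlDr lt_min; lra.
rewrite -(gK (f x + d)); apply: fi.
by move: y2; rewrite -ltrBlDl lt_min; lra.
Qed.

Lemma inverse_increasing f g : increasing f -> cancel g f -> increasing g.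
Proof.
move=> fi gK x y xy; rewrite ltNge; apply/negP; rewrite le_eqVlt => /orP[/eqP E|/fi].
  by move: xy; rewrite -(gK x) -E gK ltxx.
by rewrite !gK; lra.
Qed.

Definition increasing_homeo f g (fi : increasing f) (fK : cancel f g)
    (gK : cancel g f) : hR :=
  Homeo fK gK (increasing_bijection_continuous fi fK gK)
    (increasing_bijection_continuous (inverse_increasing fi gK) gK fK).

Definition bend_fun a s x := if x <= a then x else a + s * (x - a).

Lemma bend_increasing a s : 0 < s -> increasing (bend_fun a s).
Proof.
move=> s0 x y xy; rewrite /bend_fun; case: (leP x a) => xa; case: (leP y a) => ya //.
- have : 0 < s * (y - a) by rewrite mulr_gt0 // subr_gt0.
  lra.
- lra.
- by rewrite ltrD2l ltr_pM2l //; lra.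
Qed.

Lemma bendK a s : 0 < s -> cancel (bend_fun a s) (bend_fun a s^-1).
Proof.
move=> s0 x; rewrite /bend_fun; case: (leP x a) => xa; first by rewrite xa.
have p : 0 < s * (x - a) by rewrite mulr_gt0 // subr_gt0.
rewrite leNgt ifN; last by rewrite negbK; lra.
by rewrite [a + _ - a]addrC addKr mulKf ?gt_eqF // addrC subrK.
Qed.

Lemma bendVK a s : 0 < s -> cancel (bend_fun a s^-1) (bend_fun a s).
Proof.
move=> s0; have := @bendK a s^-1; rewrite invrK; apply.
by rewrite invr_gt0.
Qed.

(** Elements of Bieri-Strebel groups will be constructed as products of bends,
    for which membership is easy to verify. *)
Definition bend a s (s0 : 0 < s) : hR :=
  increasing_homeo (bend_increasing a s0) (bendK a s0) (bendVK a s0).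

Lemma bend_BieriStrebel a s (s0 : 0 < s) A P : pos_subgroup P ->
  is_submodule P A -> A a -> P s -> BieriStrebel setT A P (bend a s0).
Proof.
move=> Pg Am Aa Ps.
have bA t x : P t -> A x -> A (bend_fun a t x).
  move=> Pt Ax; rewrite /bend_fun; case: ifP => // _.
  by apply: (submoduleD Am) => //; apply: (submoduleZ Am) => //; exact: (submodule_sub Am).
have sl x : x < a -> has_slope idfun (bend a s0) x 1.
  move=> xa; apply/has_slopeP; exists (a - x); first lra.
  by move=> y y1 y2; rewrite /= /bend_fun !ifT; lra.
have sr x : a < x -> has_slope idfun (bend a s0) x s.
  move=> ax; apply/has_slopeP; exists (x - a); first lra.
  by move=> y y1 y2; rewrite /= /bend_fun !leNgt !ifN ?negbK; [ring|lra|lra].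
have bpa x : breakpoints idfun (bend a s0) x -> x = a.
  have [xa|ax|//] := ltgtP x a; first by apply: contra_notP => _; exists 1; exact: sl.
  by apply: contra_notP => _; exists s; exact: sr.
apply/BieriStrebelP; split=> //; first split.
- exact: bend_increasing.
- by apply: (@sub_finite_set _ _ [set a]) => // x /bpa.
- move=> x t xt; have [xa|ax|xa] := ltgtP x a.
  + by rewrite (has_slope_uniq xt (sl x xa)); exact: pos_subgroup1.
  + by rewrite (has_slope_uniq xt (sr x ax)).
  + have /nearR[d d0 Hd] := has_slope_near xt.
    rewrite (has_slope_uniq (Hd (a - d / 2) _ _) (sl _ _)); try lra.
    exact: pos_subgroup1.
- by move=> _ [x /bpa -> <-].
- by move=> x [].
- apply/seteqP; split=> [_ [x Ax <-]|x Ax]; first exact: bA.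
  exists (bend_fun a s^-1 x); last exact: bendVK.
  by apply: bA => //; exact: pos_subgroupV.
Qed.

End Bends.

Section Hats.
Variable R : realType.
Local Notation hR := (homeo R).
Implicit Types (f g : hR) (x y a b c s t d : R) (P A I : set R).

(** Slope [s] on an interval of length [t] starting at [a], then slope 1/s until
    the graph meets the diagonal again, after a further length s t: this is a
    product of three bends, and all the breakpoints lie in [A]. *)
Lemma hat_exists A P a t s : pos_subgroup P -> is_submodule P A ->
  A a -> A t -> P s -> 0 < t -> s < 1 ->
  exists f, [/\ BieriStrebel `[a, a + t + s * t]%classic A P f,
    right_slope f a s & forall x, a < x < a + t + s * t -> f x < x].
Proof.
move=> Pg Am Aa At Ps t0 s1; have s0 := pos_subgroup_gt0 Pg Ps.
have Ast : A (s * t) by exact: (submoduleZ Am).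
have st0 : 0 < s * t by exact: mulr_gt0.
have Aast : A (a + s * t) by exact: (submoduleD Am).
have Ac : A (a + s * t + t) by exact: (submoduleD Am).
have Ps2 : P (s^-1 * s^-1) by apply: pos_subgroupM => //; exact: pos_subgroupV.
have s20 := pos_subgroup_gt0 Pg Ps2.
pose f : hR := (bend (a + s * t + t) s0 * (bend (a + s * t) s20 * bend a s0))%g.
have fB : BieriStrebel setT A P f.
  by do 2 (apply: BieriStrebelM => //; first exact: bend_BieriStrebel);
     exact: bend_BieriStrebel.
have f1 x : x <= a -> f x = x.
  by move=> xa; rewrite /f /= /bend_fun (ifT _ _ xa) ifT ?ifT; lra.
have ale x y : a < x -> (a + s * (x - a) <= a + s * y) = (x <= a + y).
  by move=> ax; rewrite lerD2l ler_pM2l // lerBlDl.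
have f2 x : a < x <= a + t -> f x = a + s * (x - a).
  move=> /andP[ax xt]; rewrite /f /= /bend_fun.
  rewrite (leNgt x a) ax /= ale // xt ifT //.
  by have := ale x t ax; rewrite xt; lra.
have f3 x : a + t < x -> bend_fun (a + s * t) (s^-1 * s^-1) (bend_fun a s x)
    = a + s * t + (x - a - t) / s.
  move=> atx; rewrite /bend_fun (leNgt x a) (_ : a < x) /=; last lra.
  rewrite ale; last lra.
  rewrite leNgt atx /= -mulrA; congr (_ + _).
  rewrite (_ : a + _ - _ = s * (x - a - t)); last ring.
  by rewrite mulKf ?gt_eqF // mulrC.
have f3' x : a + t < x <= a + t + s * t -> f x = a + s * t + (x - a - t) / s.
  move=> xI; rewrite /f /= f3; last lra.
  rewrite /bend_fun ifT // lerD2l ler_pdivrMr // [t * s]mulrC; lra.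
have f4 x : a + t + s * t < x -> f x = x.
  move=> xI; rewrite /f /= f3; last lra.
  have sE : s * ((x - a - t) / s) = x - a - t by rewrite mulrC divfK ?gt_eqF.
  rewrite /bend_fun leNgt ltrD2l ltr_pdivlMr // [t * s]mulrC ifN.
    rewrite (_ : a + s * t + _ - _ = (x - a - t) / s - t); last ring.
    by rewrite mulrBr sE; ring.
  by rewrite negbK; lra.
exists f; split.
- apply: BieriStrebel_support fB => x; rewrite /= in_itv /= => xI.
  by have [/f1//|ax] := leP x a; apply: f4; rewrite ltNge; apply/negP; lra.
- exists t => // x xI; have [xa|ax] := leP x a; last by apply: f2; lra.
  by rewrite f1 // (_ : x = a); [ring|lra].
- move=> x xI; have [xt|tx] := leP x (a + t).
    rewrite f2; last lra.
    have : s * (x - a) < 1 * (x - a) by rewrite ltr_pM2r //; lra.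
    lra.
  rewrite f3'; last lra.
  set y := (x - a - t) / s.
  have yE : x = a + t + s * y by rewrite /y [s * _]mulrC divfK ?gt_eqF //; ring.
  have ys : y < t by rewrite /y ltr_pdivrMr // [t * s]mulrC; lra.
  have : (1 - s) * y < (1 - s) * t by rewrite ltr_pM2l //; lra.
  lra.
Qed.

End Hats.

(** * Elements and double commutators with small support *)

Section SourceGroup.
Variable R : realType.
Local Notation hR := (homeo R).
Implicit Types (f g u : hR) (x y a b c d l r s t : R).
Variables (A P : set R) (s0 : R).
Hypotheses (Pg : pos_subgroup P) (Am : is_submodule P A)
  (A_dense : forall l r, l < r -> exists2 x, A x & l < x < r)
  (Ps0 : P s0) (s0_lt1 : s0 < 1).
Local Notation BS c d := (BieriStrebel `[c, d]%classic A P).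

Lemma BS_supportP c d f x : BS c d f -> f x <> x -> c <= x <= d.
Proof.
move=> /BieriStrebelP[_ fI _]; apply: contra_notP => xI; apply: fI.
by rewrite /= in_itv.
Qed.

Lemma BS_fix c d f x : BS c d f -> ~~ (c <= x <= d) -> f x = x.
Proof. by move=> Bf /negP xI; apply: contrapT => /(BS_supportP Bf). Qed.

Lemma BS_sub a b c d f : a <= c -> d <= b -> BS c d f -> BS a b f.
Proof. by move=> ac db; apply: BieriStrebel_sub => x; rewrite /= !in_itv /=; lra. Qed.

(** Elements with a given slope at [a] can be supported arbitrarily close
    to [a]: hats, their inverses, or the identity. *)
Lemma small_slope a d s : A a -> 0 < d -> P s ->
  exists2 f, BS a (a + d) f & right_slope f a s.
Proof.
move=> Aa d0 Ps.
have key t : P t -> t < 1 -> exists2 f, BS a (a + d) f & right_slope f a t.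
  move=> Pt t1; have [e Ae /andP[e0 ed]] := A_dense (ltac:(lra) : 0 < d / 2).
  have t0 := pos_subgroup_gt0 Pg Pt.
  have [f [fB fs _]] := hat_exists Pg Am Aa Ae Pt e0 t1.
  exists f => //; apply: BS_sub fB => //.
  have : t * e < 1 * e by rewrite ltr_pM2r.
  lra.
have [s1|s1|->] := ltgtP s 1; first exact: key.
- have [||f fB fs] := key s^-1.
  + exact: pos_subgroupV.
  + by rewrite invf_lt1 // (pos_subgroup_gt0 Pg Ps).
  + exists (f^-1)%g; first exact: BieriStrebelV.
    by rewrite -(invrK s); apply: right_slopeV => //; exact: BieriStrebel_increasing fB.
- by exists 1%g; [exact: BieriStrebel1|exact: right_slope1].
Qed.

Lemma contraction_between l r : l < r -> exists a c f,
  [/\ [/\ l < a, a < c & c < r], A a, A c, BS a c f & forall x, a < x < c -> f x < x].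
Proof.
move=> lr; have [a Aa /andP[la ar]] := A_dense lr.
have [t At /andP[t0 tr]] := A_dense (ltac:(lra) : 0 < (r - a) / 2).
have s00 := pos_subgroup_gt0 Pg Ps0.
have st : 0 < s0 * t by rewrite mulr_gt0.
have st' : s0 * t < 1 * t by rewrite ltr_pM2r.
have [f [fB _ fx]] := hat_exists Pg Am Aa At Ps0 t0 s0_lt1.
exists a, (a + t + s0 * t), f; split=> //; first by split; lra.
by apply: (submoduleD Am); [exact: (submoduleD Am)|exact: (submoduleZ Am)].
Qed.

(** If [f] moves a small interval off itself and [g] is supported there, then
    on this interval the commutator of [f] and [g] is [g] itself. *)
Lemma nontrivial_commutators (Q : R -> R -> set hR) :
  (forall c d f x, Q c d f -> f x <> x -> c <= x <= d) ->
  (forall a b c d, a <= c -> d <= b -> Q c d `<=` Q a b) ->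
  (forall c d, c < d -> exists2 f, Q c d f & exists x, f x <> x) ->
  forall c d, c < d -> exists f g, [/\ Q c d f, Q c d g & exists x, [~ f, g]%g x <> x].
Proof.
move=> Qsupp Qsub Qex c d cd; have [f Qf [x fx]] := Qex c d cd.
(* near [x], the values of [f] stay away from [x] *)
have [e' e'0 He'] : exists2 e', 0 < e' & forall y, x - e' < y -> y < x + e' ->
    `|f y - x| > e'.
  pose m := `|f x - x| / 2.
  have m0 : 0 < m by rewrite divr_gt0 // normr_gt0 subr_eq0; apply/eqP.
  have : \forall y \near x, `|f y - f x| < m.
    have := @homeo_continuous _ f x => /cvgrPdist_lt/(_ m m0).
    by apply: filterS => y; rewrite distrC.
  move=> /nearR[k k0 Hk].
  exists (Num.min k m); first by rewrite lt_min k0.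
  move=> y; rewrite ltrBlDr -ltrBlDl => y1 y2.
  have km : Num.min k m <= m by rewrite ge_min lexx orbT.
  have kk : Num.min k m <= k by rewrite ge_min lexx.
  have := Hk y ltac:(lra) ltac:(lra) => fy.
  have := ler_distD (f y) (f x) x; rewrite [`|f x - f y|]distrC.
  have : `|f x - x| = m + m by rewrite /m; lra.
  lra.
have cxd := Qsupp _ _ _ _ Qf fx.
pose l := Num.max c (x - e' / 2); pose r := Num.min d (x + e' / 2).
have lr : l < r by rewrite /l /r gt_max !lt_min; lra.
have [cl xl] : c <= l /\ x - e' / 2 <= l by rewrite /l !le_max !lexx orbT.
have [rd rx] : r <= d /\ r <= x + e' / 2 by rewrite /r !ge_min !lexx orbT.
have [g Qg [z gz]] := Qex l r lr.
exists f, g; split=> //; first exact: Qsub Qg.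
exists z => E; apply: gz.
have ggz : g (g z) <> g z -> l <= g z <= r by exact: Qsupp Qg.
have [gzE|/eqP gz] := eqVneq (g z) z; first exact: gzE.
have gI : l <= g z <= r by apply: ggz => /homeo_inj.
have fI : ~ (l <= f (g z) <= r).
  have := He' (g z) ltac:(lra) ltac:(lra); rewrite ltr_normr; lra.
have gf : g (f (g z)) = f (g z) by apply: contrapT => /(Qsupp _ _ _ _ Qg).
apply: (@homeo_inj _ f); apply: (@homeo_inj _ g); rewrite gf.
by rewrite -[in RHS]E commgE homeoME -[g (f _)]homeoME homeoKV.
Qed.

Definition double_commutators (E : set hR) : set hR :=
  [set u | exists f1 f2 f3 f4,
    [/\ E f1, E f2, E f3, E f4 & u = [~ [~ f1, f2], [~ f3, f4]]%g]].

(** The groups themselves satisfy the hypotheses of the previous lemma, and then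
    so do their commutators. *)
Lemma double_commutators_exist c d : c < d ->
  exists2 u, double_commutators (BS c d) u & exists x, u x <> x.
Proof.
pose Q1 a b : set hR := [set u | exists f g, [/\ BS a b f, BS a b g & u = [~ f, g]%g]].
have supp1 a b f x : BS a b f -> f x <> x -> a <= x <= b by exact: BS_supportP.
have sub1 a b c' d' : a <= c' -> d' <= b -> BS c' d' `<=` BS a b.
  by move=> ac db f; exact: BS_sub.
have ex1 a b : a < b -> exists2 f, BS a b f & exists x, f x <> x.
  move=> ab; have [a' [c' [f [[aa' ac' cb] _ _ fB fx]]]] := contraction_between ab.
  exists f; first by apply: BS_sub fB; exact: ltW.
  exists ((a' + c') / 2); have := fx ((a' + c') / 2); lra.
have ex2 a b : a < b -> exists2 f, Q1 a b f & exists x, f x <> x.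
  move=> /(nontrivial_commutators supp1 sub1 ex1)[f [g [Bf Bg Hx]]].
  by exists [~ f, g]%g => //; exists f, g.
have supp2 a b f x : Q1 a b f -> f x <> x -> a <= x <= b.
  by move=> [g [h [Bg Bh ->]]]; apply: BS_supportP; exact: BieriStrebelR.
have sub2 a b c' d' : a <= c' -> d' <= b -> Q1 c' d' `<=` Q1 a b.
  move=> ac db _ [g [h [Bg Bh ->]]]; exists g, h.
  by split=> //; [exact: BS_sub Bg|exact: BS_sub Bh].
move=> cd; have [_ [_ [[f1 [f2 [B1 B2 ->]]] [f3 [f4 [B3 B4 ->]]] Hx]]] :=
  nontrivial_commutators supp2 sub2 ex2 cd.
by eexists; last exact: Hx; exists f1, f2, f3, f4.
Qed.

Lemma double_commutators_BS c d : double_commutators (BS c d) `<=` BS c d.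
Proof.
move=> _ [f1 [f2 [f3 [f4 [E1 E2 E3 E4 ->]]]]].
by do 2?apply: BieriStrebelR => //; exact: BieriStrebelR.
Qed.

End SourceGroup.

(** * Germs of an embedding *)

Section Embeddings.
Variable R : realType.
Local Notation hR := (homeo R).
Implicit Types (f g h u v w k : hR) (x y z a b c d e l r s t : R) (A P Q : set R).
Local Notation PLh P := (@PL_homeos R R idfun P setT).
Local Notation BS A P c d := (BieriStrebel `[c, d]%classic A P).

Definition PL_embedding a b A P Q (phi : hR -> hR) :=
  [/\ forall f, BS A P a b f -> PLh Q (phi f),
      forall f g, BS A P a b f -> BS A P a b g -> phi (f * g)%g = (phi f * phi g)%g &
      forall f g, BS A P a b f -> BS A P a b g -> phi f = phi g -> f = g].

Definition injective_hom P Q (chi : R -> R) :=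
  [/\ forall s, P s -> Q (chi s), forall s t, P s -> P t -> chi (s * t) = chi s * chi t &
      forall s t, P s -> P t -> chi s = chi t -> s = t].

Lemma BS_fix_ends A P c d f : BS A P c d f -> f c = c /\ f d = d.
Proof.
move=> Bf; split; apply: contrapT => /near_moved/nearR[e e0 He].
  have /(BS_supportP Bf) := He (c - e / 2) ltac:(lra) ltac:(lra); lra.
have /(BS_supportP Bf) := He (d + e / 2) ltac:(lra) ltac:(lra); lra.
Qed.

Lemma BS_conj A P a b c d f h : pos_subgroup P -> a <= c -> d <= b ->
  BS A P a b h -> BS A P c d f -> BS A P (h c) (h d) (f ^ h^-1)%g.
Proof.
move=> Pg ac db Bh Bf; have Bf' := BS_sub ac db Bf.
have hi := BieriStrebel_increasing Bh.
apply: (@BieriStrebel_support _ `[a, b]%classic); last first.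
  rewrite /conjg invgK; apply: BieriStrebelM => //.
  by apply: BieriStrebelM => //; exact: BieriStrebelV.
move=> x nI; have xI : ~ (h c <= x <= h d) by move: nI; rewrite /= in_itv.
rewrite /conjg !homeoME invgK.
rewrite (BS_fix Bf) ?homeoKV //; apply/negP => /andP[cx xd]; apply: xI.
by rewrite -(homeoKV h x) !increasing_le.
Qed.

Lemma double_commutators_conj A P a b c d u h : pos_subgroup P -> a <= c -> d <= b ->
  BS A P a b h -> double_commutators (BS A P c d) u ->
  double_commutators (BS A P (h c) (h d)) (u ^ h^-1)%g.
Proof.
move=> Pg ac db Bh [f1 [f2 [f3 [f4 [B1 B2 B3 B4 ->]]]]].
exists (f1 ^ h^-1)%g, (f2 ^ h^-1)%g, (f3 ^ h^-1)%g, (f4 ^ h^-1)%g.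
by rewrite !conjRg; split=> //; exact: (BS_conj Pg ac db Bh).
Qed.

Lemma PL_embedding_reflect_target a b A P Q phi :
  PL_embedding a b A P Q phi -> PL_embedding a b A P Q (@reflect_homeo R \o phi).
Proof.
move=> [pPL pM pI]; split=> [f Bf|f g Bf Bg|f g Bf Bg] /=.
- by apply: reflect_PL => //; exact: pPL.
- by rewrite pM // reflect_homeoM.
- by move=> /(can_inj (@reflect_homeoK R)); exact: pI.
Qed.

Lemma PL_embedding_reflect_source a b A P Q phi : (forall x, A x -> A (- x)) ->
  PL_embedding a b A P Q phi ->
  PL_embedding (- b) (- a) A P Q (phi \o @reflect_homeo R).
Proof.
move=> AN [pPL pM pI].
have refl f : BS A P (- b) (- a) f -> BS A P a b (reflect_homeo f).
  by move=> /(reflect_BieriStrebel AN); rewrite !opprK.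
split=> [f /refl Bf|f g /refl Bf /refl Bg|f g /refl Bf /refl Bg] /=.
- exact: pPL.
- by rewrite reflect_homeoM pM.
- by move=> /(pI _ _ Bf Bg)/(can_inj (@reflect_homeoK R)).
Qed.

End Embeddings.

Section EndGerms.
Variable R : realType.
Local Notation hR := (homeo R).
Implicit Types (f g h u v w k : hR) (x y z a b c d e l r s t : R).
Local Notation PLh P := (@PL_homeos R R idfun P setT).
Variables (A P Q : set R) (a0 b0 : R) (phi : hR -> hR).
Hypotheses (Pg : pos_subgroup P) (Am : is_submodule P A)
  (A_dense : forall l r, l < r -> exists2 x, A x & l < x < r)
  (phiP : PL_embedding a0 b0 A P Q phi).
Local Notation BS c d := (BieriStrebel `[c, d]%classic A P).
Local Notation G := (BS a0 b0).

Let GM f g : G f -> G g -> G (f * g)%g. Proof. exact: BieriStrebelM. Qed.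
Let GV f : G f -> G (f^-1)%g. Proof. exact: BieriStrebelV. Qed.
Let GR f g : G f -> G g -> G [~ f, g]%g. Proof. exact: BieriStrebelR. Qed.
Let GX f n : G f -> G (f ^+ n)%g. Proof. exact: BieriStrebelX. Qed.
Let G1 : G 1%g. Proof. exact: BieriStrebel1. Qed.

Lemma phi_PL f : G f -> PLh Q (phi f).
Proof. by move=> Gf; have [H _ _] := phiP; exact: H. Qed.

Lemma phiM f g : G f -> G g -> phi (f * g)%g = (phi f * phi g)%g.
Proof. by move=> Gf Gg; have [_ H _] := phiP; exact: H. Qed.

Lemma phi_inj f g : G f -> G g -> phi f = phi g -> f = g.
Proof. by move=> Gf Gg; have [_ _ H] := phiP; exact: H. Qed.

Lemma phi_increasing f : G f -> increasing (phi f).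
Proof. by move=> /phi_PL/PL_increasing. Qed.

Lemma phi1 : phi 1%g = 1%g.
Proof. by apply: (@monoid.mulgI _ (phi 1%g)); rewrite -phiM // !mulg1. Qed.

Lemma phiV f : G f -> phi (f^-1)%g = ((phi f)^-1)%g.
Proof.
move=> Gf; apply: (@monoid.mulgI _ (phi f)).
by rewrite -phiM //; [rewrite !mulgV phi1|exact: GV].
Qed.

Lemma phiX f n : G f -> phi (f ^+ n)%g = (phi f ^+ n)%g.
Proof.
move=> Gf; elim: n => [|n IH]; first exact: phi1.
by rewrite !expgS phiM ?IH //; exact: GX.
Qed.

Lemma phiR f g : G f -> G g -> phi [~ f, g]%g = [~ phi f, phi g]%g.
Proof.
move=> Gf Gg; rewrite !commgE phiM ?phiV ?phiM //; try exact: GM.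
by apply: GV; exact: GM.
Qed.

Lemma phiJ f h : G f -> G h -> phi (f ^ h^-1)%g = (phi f ^ (phi h)^-1)%g.
Proof.
move=> Gf Gh; have Gh' := GV Gh.
rewrite /conjg !invgK phiM ?phiM ?phiV //; last exact: GM.
Qed.

Lemma phi_commute f g : G f -> G g -> commute f g -> commute (phi f) (phi g).
Proof. by move=> Gf Gg fg; rewrite /commute -!phiM // fg. Qed.

Lemma phi_moves f x : G f -> f x <> x -> exists z, phi f z <> z.
Proof.
move=> Gf fx; apply: contrapT => /forallNP H; apply: fx.
suff -> : f = 1%g by [].
apply: phi_inj => //; rewrite phi1; apply: homeo_ext => z.
exact: contrapT (H z).
Qed.

Lemma double_commutators_G c d u : a0 <= c -> d <= b0 ->
  double_commutators (BS c d) u -> G u.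
Proof. by move=> ac db /(double_commutators_BS Pg)/(BS_sub ac db). Qed.

Lemma phi_double_commutator_fixes_below c d u x : a0 <= c -> d <= b0 ->
  double_commutators (BS c d) u -> exists2 z, z < x & phi u z = z.
Proof.
move=> ac db [f1 [f2 [f3 [f4 [/(BS_sub ac db) B1 /(BS_sub ac db) B2
  /(BS_sub ac db) B3 /(BS_sub ac db) B4 ->]]]]].
rewrite !phiR //; try exact: GR.
have [M HM] := double_commutator_fixes_below (phi_PL B1) (phi_PL B2) (phi_PL B3) (phi_PL B4).
exists (Num.min M (x - 1)); last by apply: HM; rewrite ge_min lexx.
by rewrite gt_min; lra.
Qed.

(** When [h] moves [c, d] off itself, the group supported in [c, d] commutes
    with its conjugate by [h]. *)
Lemma phi_double_commutator_wanders h c d u b x z : a0 <= c -> d <= b0 -> G h ->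
  h d < c \/ d < h c -> double_commutators (BS c d) u ->
  phi u b = b -> (forall y, b < y <= z -> phi u y <> y) ->
  b < x <= z -> ~ (b < phi h x <= z).
Proof.
move=> ac db Gh hcd uD ub um bxz.
have Gu := double_commutators_G ac db uD.
have hi := BieriStrebel_increasing Gh.
have hcd' f g : BS c d f -> BS c d g -> commute f (g ^ h^-1)%g.
  move=> Bf Bg; apply: (@disjoint_supports_commute _ _ _ `[c, d]%classic `[h c, h d]%classic).
  - by move=> y /negP; rewrite in_itv; exact: (BS_fix Bf).
  - by move=> y /negP; rewrite in_itv; exact: (BS_fix (BS_conj Pg ac db Gh Bg)).
  - by move=> y; rewrite /= !in_itv /=; case: hcd; lra.
have Gc f : G f -> G (f ^ h^-1)%g.
  by move=> Gf; rewrite /conjg invgK; apply: GM => //; apply: GM => //; exact: GV.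
have sub f : BS c d f -> G f by exact: BS_sub.
have Bu := double_commutators_BS Pg uD.
case: uD => f1 [f2 [f3 [f4 [B1 B2 B3 B4 uE]]]].
pose m1 := [~ f1, f2]%g; pose m2 := [~ f3, f4]%g.
have Bm1 : BS c d m1 by exact: BieriStrebelR.
have Bm2 : BS c d m2 by exact: BieriStrebelR.
have Gm1 := sub _ Bm1; have Gm2 := sub _ Bm2.
have pu : phi u = [~ phi m1, phi m2]%g by rewrite uE phiR.
have cm f : BS c d f -> commute (phi u) (phi f ^ (phi h)^-1)%g.
  move=> Bf; have Gf := sub _ Bf; rewrite -phiJ //.
  by apply: phi_commute => //; [exact: Gc|exact: hcd'].
rewrite pu in ub um.
have cu := cm _ Bu; have c1 := cm _ Bm1; have c2 := cm _ Bm2.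
have Pu := phi_PL Gu; have Puc := phi_PL (Gc _ Gu); rewrite phiJ // in Puc.
rewrite !pu in cu c1 c2 Pu Puc.
exact: (commutator_wanders Pu Puc (phi_increasing Gh) (phi_PL Gm1) (phi_PL Gm2)
  cu c1 c2 ub um bxz).
Qed.

(** The moved points [x] come with a fixed point [b], also close to [y], so that
    a component of the support, and not only a part of it, has an end
    close to [y]. *)
Definition clusters_at a y := forall d e, 0 < d -> 0 < e ->
  exists c c' u, [/\ a < c, c < c', c' < a + d, double_commutators (BS c c') u &
    exists b x, [/\ y < b, b < x, x < y + e, phi u b = b & phi u x <> x]].

(** The iterates under [phi h] of a component displaced to the left decrease to
    a fixed point [y] of [phi h]; they are components for the conjugates of [u]
    by the powers of [h], and these are concentrated near [a]. *)
Lemma clustering_exists h a c1 c d u x z : a0 <= a -> c1 <= b0 -> G h ->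
  h a = a -> (forall t, a < t < c1 -> h t < t) ->
  a < c -> c < d -> d < c1 -> h d < c -> double_commutators (BS c d) u ->
  phi u x <> x -> phi h z = z -> z < x -> phi h x < x ->
  exists y, clusters_at a y.
Proof.
move=> a0a c1b Gh ha hlt ac cd dc1 hdc uD ux hz zx hx.
have hi := BieriStrebel_increasing Gh; have phi_h := phi_increasing Gh.
have ac' : a0 <= c by lra. have db' : d <= b0 by lra.
have Gu := double_commutators_G ac' db' uD.
have [z0 z0x uz0] := phi_double_commutator_fixes_below x ac' db' uD.
have [b [_ bx ub um]] := last_fixed_point uz0 z0x ux.
have hxb : phi h x <= b.
  rewrite leNgt; apply/negP => bhx.
  apply: (phi_double_commutator_wanders ac' db' Gh (or_introl hdc) uD ub um (x := x)).
    by rewrite bx lexx.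
  by rewrite bhx ltW.
have [y [zy yx hy Hy]] := iterates_converge phi_h hz zx hx.
have [y' [ay' y'd hy' Hy']] := iterates_converge hi ha (ltac:(lra) : a < d) (hlt d ltac:(lra)).
have ya : y' = a.
  apply/eqP; rewrite eq_le ay' andbT leNgt; apply/negP => ay.
  by have := hlt y' ltac:(lra); rewrite hy' ltxx.
rewrite {}ya in Hy'.
exists y => e e' e0 e'0.
have [n1 Hn1] := Hy' _ e0; have [n2 Hn2] := Hy _ e'0.
pose n := maxn n1 n2.
have /andP[nd1 nd2] := Hn1 n (leq_maxl _ _).
have hni : increasing (h ^+ n)%g by exact: increasingX.
have pni : increasing (phi h ^+ n)%g by exact: increasingX.
exists ((h ^+ n)%g c), ((h ^+ n)%g d), (u ^ (h ^+ n)^-1)%g; split=> //.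
- by rewrite -(iterate_fixed n ha); exact: hni.
- exact: hni.
- by apply: (double_commutators_conj Pg ac' db') => //; exact: GX.
have cE t : phi (u ^ (h ^+ n)^-1)%g ((phi h ^+ n)%g t) = (phi h ^+ n)%g (phi u t).
  rewrite phiJ // ?phiX //; last exact: GX.
  by rewrite /conjg !homeoME homeoVK invgK.
exists ((phi h ^+ n)%g b), ((phi h ^+ n)%g x); split.
- have /andP[+ _] := Hn2 n.+1 (leq_trans (leq_maxr _ _) (leqnSn _)).
  move=> /lt_le_trans; apply; rewrite expgSr homeoME; exact: increasing_le.
- exact: pni.
- by have /andP[] := Hn2 n (leq_maxr _ _).
- by rewrite cE ub.
- by rewrite cE => /homeo_inj.
Qed.

Variables (a y : R).
Hypotheses (a0a : a0 <= a) (ab0 : a < b0) (Aa : A a) (ay : clusters_at a y).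

Let accum e e' : 0 < e -> 0 < e' ->
  exists c c' u, [/\ a < c, c' < a + e, c' < b0, double_commutators (BS c c') u &
    [/\ G u, c < c' & exists b x, [/\ y < b, b < x, x < y + e', phi u b = b & phi u x <> x]]].
Proof.
have [a0a' ab0'] := (a0a, ab0).
move=> e_0 e'0; have m0 : 0 < Num.min e (b0 - a) by rewrite lt_min e_0 subr_gt0.
have [c [c' [u [ac cc ce uD H]]]] := ay m0 e'0.
move: ce; rewrite -ltrBlDl lt_min => /andP[ce cb].
exists c, c', u; split=> //; try lra; split=> //.
by apply: double_commutators_G uD; lra.
Qed.

(** The image of [w] commutes with elements whose moved components accumulate
    at [y], and so fixes points accumulating at [y]. *)
Lemma phi_trivial_germ w : G w -> right_slope w a 1 -> right_slope (phi w) y 1.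
Proof.
move=> Gw [e e_0 He].
have [s [d [Qs d0 Hd]]] := PL_right_affine y (phi_PL Gw).
have fixed e' : 0 < e' -> exists2 x, y < x < y + e' & phi w x = x.
  move=> e'0; have [c [c' [u [ac ce cb uD [Gu cc [b [x [yb bx xe ub ux]]]]]]]] := accum e_0 e'0.
  have uw : commute u w.
    apply: (@disjoint_supports_commute _ _ _ `[c, c']%classic [set t | w t <> t]).
    - move=> t /negP; rewrite in_itv; exact: (BS_fix (double_commutators_BS Pg uD)).
    - by move=> t /= /contrapT.
    - move=> t; rewrite /= in_itv /= => tI; apply.
      by rewrite He ?mul1r; [rewrite addrC subrK|lra].
  have [z zI wz] := commute_fixed_point (phi_PL Gu) (phi_increasing Gw)
    (phi_commute Gu Gw uw) ub ux (ltW bx).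
  by exists z => //; lra.
have [x1 x1I wx1] := fixed d d0.
have [x2 x2I wx2] := fixed (x1 - y) ltac:(lra).
have E1 := Hd x1 ltac:(lra); have E2 := Hd x2 ltac:(lra).
rewrite wx1 in E1; rewrite wx2 in E2.
have s1 : s = 1.
  have n0 : x1 - x2 != 0 by rewrite subr_eq0 gt_eqF; lra.
  by apply: (mulIf n0); lra.
exists d => // x xI; rewrite Hd // s1; rewrite s1 in E1; lra.
Qed.

(** Otherwise [k] could be replaced by an element with the same germ at [a] and
    support so close to [a] that it commutes with a given [u]; the image of [u]
    would then be trivial between [y] and its image, for every [u] close
    to [a]. *)
Lemma phi_fixes_accumulation_point k s : G k -> P s -> right_slope k a s -> phi k y = y.
Proof.
have [a0a' ab0'] := (a0a, ab0).
have key k' t : G k' -> P t -> right_slope k' a t -> ~ (y < phi k' y).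
  move=> Gk Pt kt yk.
  have [c [c' [u [ac _ cb uD [Gu cc [b [x [yb bx xk ub ux]]]]]]]] :=
    accum ltr01 (ltac:(lra) : 0 < phi k' y - y).
  have Bu := double_commutators_BS Pg uD.
  have [f Bf ft] := small_slope Pg Am A_dense Aa (ltac:(lra) : 0 < (c - a) / 2) Pt.
  have Gf : G f by apply: BS_sub Bf; lra.
  have fu : commute u f.
    apply: (@disjoint_supports_commute _ _ _ `[c, c']%classic `[a, a + (c - a) / 2]%classic).
    - by move=> z /negP; rewrite in_itv; exact: (BS_fix Bu).
    - by move=> z /negP; rewrite in_itv; exact: (BS_fix Bf).
    - by move=> z; rewrite /= !in_itv /=; lra.
  have fi := BieriStrebel_increasing Gf; have ki := BieriStrebel_increasing Gk.
  have fk : right_slope (f^-1 * k')%g a 1.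
    rewrite -(@mulVf _ t) ?gt_eqF ?(pos_subgroup_gt0 Pg Pt) //.
    by apply: right_slopeM => //; exact: right_slopeV.
  have /phi_trivial_germ/(_ fk)/right_slope_fix : G (f^-1 * k')%g by apply: GM => //; exact: GV.
  rewrite phiM ?phiV //; last exact: GV.
  move=> /(congr1 (phi f)); rewrite homeoME homeoKV => kf.
  have uy : phi u y = y.
    apply: right_slope_fix (phi_trivial_germ Gu _).
    exists (c - a); first lra.
    move=> z zI; rewrite mul1r [RHS]addrC subrK; apply: contrapT => /[dup] uz /(BS_supportP Bu) zI'.
    by apply: uz; rewrite (_ : z = c); [have [] := BS_fix_ends Bu|lra].
  rewrite kf in yk xk.
  apply: ux; apply: (fix_up_to_image (phi_PL Gu) (phi_increasing Gf) _ uy yk); last lra.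
  exact: phi_commute.
move=> Gk Ps ks; have [yk|yk|//] := ltgtP y (phi k y).
  by have := key k s Gk Ps ks yk.
exfalso; apply: (key (k^-1)%g s^-1); [exact: GV|exact: pos_subgroupV| |].
  by apply: right_slopeV => //; exact: BieriStrebel_increasing Gk.
rewrite phiV // -[ltLHS](homeoVK (phi k)).
by apply: increasingV => //; exact: phi_increasing.
Qed.

(** A power of [k] moves a segment close to [a] off itself, so its image moves
    all the points moved by double commutators supported there; these points
    accumulate at [y]. *)
Lemma phi_faithful_slope k s : G k -> right_slope k a s -> s < 1 ->
  ~ right_slope (phi k) y 1.
Proof.
have [a0a' ab0'] := (a0a, ab0).
move=> Gk ks s1 [e' e'0 He'].
have ki := BieriStrebel_increasing Gk.
have sgt := right_slope_gt0 ki ks.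
have [e e_0 He] := ks.
have [c [c' [u [ac ce cb uD [Gu cc [b [x [yb bx xe ub ux]]]]]]]] := accum e_0 e'0.
have [b' [bb' b'x ub' um]] := last_fixed_point ub bx ux.
have [n Hn] : exists n, s ^+ n * (c' - a) < c - a.
  have ns : `|s| < 1 by rewrite gtr0_norm.
  have q0 : 0 < (c - a) / (c' - a) by rewrite divr_gt0 // subr_gt0; lra.
  have [n _ /(_ n (leqnn n)) Hn] := cvgr_lt _ (cvg_expr ns) _ q0.
  by exists n; rewrite -ltr_pdivlMr // subr_gt0; lra.
have kn m : (k ^+ m)%g c' = a + s ^+ m * (c' - a).
  elim: m => [|m IH]; first by rewrite expr0 mul1r addrC subrK.
  have p : 0 <= s ^+ m * (c' - a) <= 1 * (c' - a).
    have c'a : 0 <= c' - a by lra.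
    apply/andP; split; first by rewrite mulr_ge0 // exprn_ge0 // ltW.
    by rewrite ler_wpM2r // exprn_ile1 // ltW.
  by rewrite expgS homeoME IH He ?exprS; [ring|lra].
have kx : phi (k ^+ n)%g x = x.
  rewrite phiX //; apply: iterate_fixed; rewrite He'; lra.
apply: (phi_double_commutator_wanders _ _ (GX n Gk) _ uD ub' um (x := x)); try lra.
by left; rewrite kn; lra.
Qed.

(** The slope at [y] of the image of an element depends only on its slope
    at [a], and this dependence is the homomorphism. *)
Lemma slope_homomorphism : exists chi, injective_hom P Q chi.
Proof.
have [a0a' ab0'] := (a0a, ab0).
have H s : exists t, P s -> Q t /\ forall k, G k -> right_slope k a s -> right_slope (phi k) y t.
  have [Ps|nP] := pselect (P s); last by exists 0.
  have [f Bf fs] := small_slope Pg Am A_dense Aa (ltac:(lra) : 0 < b0 - a) Ps.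
  have Gf : G f by apply: BS_sub Bf; lra.
  have [t Qt ft] := PL_right_slope (phi_PL Gf) (phi_fixes_accumulation_point Gf Ps fs).
  exists t => _; split=> // k Gk ks.
  have fi := BieriStrebel_increasing Gf; have ki := BieriStrebel_increasing Gk.
  have kf : right_slope (k * f^-1)%g a 1.
    rewrite -(@mulfV _ s) ?gt_eqF ?(pos_subgroup_gt0 Pg Ps) //.
    by apply: right_slopeM => //; [exact: increasingV|exact: right_slopeV].
  have Gkf : G (k * f^-1)%g by apply: GM => //; exact: GV.
  have := right_slopeM (phi_increasing Gf) (phi_trivial_germ Gkf kf) ft.
  by rewrite -phiM // mulgVK mul1r.
have [chi Hchi] := choice H; exists chi.
have ex s : P s -> exists k, [/\ G k, right_slope k a s & right_slope (phi k) y (chi s)].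
  move=> Ps; have [k Bk ks] := small_slope Pg Am A_dense Aa (ltac:(lra) : 0 < b0 - a) Ps.
  have Gk : G k by apply: BS_sub Bk; lra.
  by exists k; split=> //; have [_] := Hchi s Ps; exact.
split.
- by move=> s Ps; have [] := Hchi s Ps.
- move=> s t Ps Pt; have [f [Gf fs pf]] := ex s Ps; have [g [Gg gt_ pg]] := ex t Pt.
  have [_ /(_ (f * g)%g (GM Gf Gg)) Hst] := Hchi _ (pos_subgroupM Pg Ps Pt).
  apply: (right_slope_uniq (Hst (right_slopeM (BieriStrebel_increasing Gg) fs gt_))).
  by rewrite phiM //; exact: (right_slopeM (phi_increasing Gg)).
- have lt s t : P s -> P t -> chi s = chi t -> ~ (s < t).
    move=> Ps Pt E st; have [f [Gf fs pf]] := ex s Ps; have [g [Gg gt_ pg]] := ex t Pt.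
    have t0 := pos_subgroup_gt0 Pg Pt.
    have c0 := right_slope_gt0 (phi_increasing Gg) pg.
    apply: (@phi_faithful_slope (f * g^-1)%g (s / t)).
    + by apply: GM => //; exact: GV.
    + apply: right_slopeM => //; first exact/increasingV/(BieriStrebel_increasing Gg).
      by apply: right_slopeV => //; exact: (BieriStrebel_increasing Gg).
    + by rewrite ltr_pdivrMr // mul1r.
    + rewrite phiM ?phiV //; last exact: GV.
      rewrite -(@mulfV _ (chi t)) ?gt_eqF // -{1}E.
      apply: right_slopeM => //; first exact/increasingV/phi_increasing.
      by apply: right_slopeV => //; exact: phi_increasing.
  move=> s t Ps Pt E; have [st|ts|//] := ltgtP s t.
    by have := lt s t Ps Pt E st.
  by have := lt t s Pt Ps (esym E) ts.
Qed.

End EndGerms.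

(** * From embeddings to homomorphisms of slopes *)

Section SlopeTransfer.
Variable R : realType.
Local Notation hR := (homeo R).
Implicit Types (f g h u v w k : hR) (x y z a b c d e l r s t : R) (A P Q : set R).

Lemma reflect_double_commutators A P c d u : (forall x, A x -> A (- x)) ->
  double_commutators (BieriStrebel `[c, d]%classic A P) u ->
  double_commutators (BieriStrebel `[- d, - c]%classic A P) (reflect_homeo u).
Proof.
move=> AN [f1 [f2 [f3 [f4 [B1 B2 B3 B4 ->]]]]].
exists (reflect_homeo f1), (reflect_homeo f2), (reflect_homeo f3), (reflect_homeo f4).
split; try exact: reflect_BieriStrebel.
by rewrite !commgE !(reflect_homeoM, reflect_homeoV).
Qed.

(** As [h] moves the segment [c', d'] off itself, [phi h] displaces the component
    of [x] in the support of [phi u].  The images of this component under the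
    positive powers of [phi h] correspond to elements concentrated near [a],
    those under the negative powers to elements concentrated near [c].  One of
    the two sequences decreases, and the fixed point [z] on its left bounds
    it. *)
Lemma slope_hom_of_displaced_component A P Q a0 b0 phi h a c c' d' u x z :
  pos_subgroup P -> is_submodule P A ->
  (forall l r, l < r -> exists2 x, A x & l < x < r) ->
  PL_embedding a0 b0 A P Q phi ->
  a0 < a -> c < b0 -> A a -> A c -> BieriStrebel `[a, c]%classic A P h ->
  (forall x, a < x < c -> h x < x) ->
  a < c' -> c' < d' -> d' < c -> h d' < c' ->
  double_commutators (BieriStrebel `[c', d']%classic A P) u ->
  phi u x <> x -> phi h z = z -> z < x ->
  exists chi, injective_hom P Q chi.
Proof.
move=> Pg Am Ad E a0a cb0 Aa Ac Bh hlt ac' cd' dc' hdc uD ux hz zx.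
have Gh : BieriStrebel `[a0, b0]%classic A P h by apply: BS_sub Bh; lra.
have [ha hc] := BS_fix_ends Bh.
have hi := BieriStrebel_increasing Gh.
have a0c' : a0 <= c' by lra. have d'b0 : d' <= b0 by lra.
have [z0 z0x uz0] := phi_double_commutator_fixes_below Pg E x a0c' d'b0 uD.
have [b [_ bx ub um]] := last_fixed_point uz0 z0x ux.
have hx : phi h x <> x.
  move=> hx; apply: (phi_double_commutator_wanders Pg E a0c' d'b0 Gh
    (or_introl hdc) uD ub um (x := x)); first by rewrite bx lexx.
  by rewrite hx bx lexx.
have [xhx|hxx|xE] := ltgtP x (phi h x); last by case: hx.
- (* the reflected situation at the end [c] *)
  have AN y : A y -> A (- y) by exact: (submoduleN Am).
  have E' := PL_embedding_reflect_source AN E.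
  pose h' := reflect_homeo (h^-1)%g.
  have phi_h' : (phi \o @reflect_homeo R) h' = ((phi h)^-1)%g.
    by rewrite /= reflect_homeoK (phiV Pg E).
  have uD' := reflect_double_commutators AN uD.
  have Bh' : BieriStrebel `[- b0, - a0]%classic A P h'.
    apply: (BS_sub (c := - c) (d := - a)); [lra|lra|].
    by apply: reflect_BieriStrebel => //; exact: BieriStrebelV.
  have h'c : h' (- c) = - c by rewrite reflect_homeoE opprK (homeo_fixV hc).
  have h'lt t : - c < t < - a -> h' t < t.
    move=> tI; rewrite reflect_homeoE ltrNl.
    apply: (increasing_ltP hi); rewrite homeoKV; apply: hlt; lra.
  have h'c' : h' (- c') < - d'.
    rewrite reflect_homeoE opprK ltrN2; apply: (increasing_ltP hi).
    by rewrite homeoKV.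
  have [||||||||y acc] := clustering_exists Pg E' (a := - c) (c1 := - a)
    (c := - d') (d := - c') (x := x) (z := z) _ _ Bh' h'c h'lt _ _ _ h'c' uD' _ _ zx _; try lra.
  + by rewrite /= reflect_homeoK.
  + by rewrite phi_h' homeo_fixV.
  + rewrite phi_h' -[ltRHS](homeoVK (phi h)).
    by apply: increasingV => //; exact: (phi_increasing E).
  by apply: (slope_homomorphism Pg Am Ad E' _ _ (AN _ Ac) acc); lra.
- have [y acc] := clustering_exists Pg E (ltW a0a) (ltW cb0) Gh ha hlt ac' cd' dc'
    hdc uD ux hz zx hxx.
  by apply: (slope_homomorphism Pg Am Ad E _ _ Aa acc); lra.
Qed.

(** The image of an element that commutes with [h] has a fixed point below each
    point that it moves, which forces a fixed point of [phi h]. *)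
Theorem slope_hom_of_embedding A P Q s0 x0 a0 b0 phi :
  pos_subgroup P -> is_submodule P A -> P s0 -> s0 < 1 -> A x0 -> x0 != 0 ->
  a0 < b0 -> PL_embedding a0 b0 A P Q phi -> exists chi, injective_hom P Q chi.
Proof.
move=> Pg Am Ps0 s01 Ax0 x00 ab E.
have Ad := submodule_dense Pg Am Ps0 s01 Ax0 x00.
pose m := (a0 + b0) / 2.
have [a [c [h [[a0a ac cm] Aa Ac Bh hlt]]]] :=
  contraction_between Pg Am Ad Ps0 s01 (ltac:(rewrite /m; lra) : a0 < m).
have mb : m < b0 by rewrite /m; lra.
have Gh : BieriStrebel `[a0, b0]%classic A P h by apply: BS_sub Bh; lra.
have hi := BieriStrebel_increasing Gh.
have [w wD [xw wx]] := double_commutators_exist Pg Am Ad Ps0 s01 mb.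
have Gw : BieriStrebel `[a0, b0]%classic A P w.
  by apply: (double_commutators_G Pg _ _ wD); lra.
have wh : commute w h.
  apply: (@disjoint_supports_commute _ _ _ `[m, b0]%classic `[a, c]%classic).
  - by move=> x /negP; rewrite in_itv; exact: (BS_fix (double_commutators_BS Pg wD)).
  - by move=> x /negP; rewrite in_itv; exact: (BS_fix Bh).
  - by move=> x; rewrite /= !in_itv /=; lra.
have [z hz] : exists z, phi h z = z.
  have [x px] := phi_moves Pg E Gw wx.
  have [y yx wy] := phi_double_commutator_fixes_below Pg E x (ltac:(lra) : a0 <= m)
    (lexx b0) wD.
  have [z _ hz] := commute_fixed_point (phi_PL E Gw) (phi_increasing E Gh)
    (phi_commute E Gw Gh wh) wy px (ltW yx).
  by exists z.
have [ha _] := BS_fix_ends Bh.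
pose d' := (a + c) / 2; pose c' := (h d' + d') / 2.
have hd' : h d' < d' by apply: hlt; rewrite /d'; lra.
have ahd : a < h d' by rewrite -ha; apply: hi; rewrite /d'; lra.
have ac' : a < c' by rewrite /c'; lra.
have cd' : c' < d' by rewrite /c'; lra.
have dc' : d' < c by rewrite /d'; lra.
have hdc : h d' < c' by rewrite /c'; lra.
have [u uD [xu ux]] := double_commutators_exist Pg Am Ad Ps0 s01 cd'.
have Gu : BieriStrebel `[a0, b0]%classic A P u.
  by apply: (double_commutators_G Pg _ _ uD); lra.
have {xu ux}[x ux] := phi_moves Pg E Gu ux.
have cb0 : c < b0 by lra.
have concl := slope_hom_of_displaced_component Pg Am Ad _ a0a cb0 Aa Ac Bh hlt
  ac' cd' dc' hdc uD.
have [zx|xz|zx] := ltgtP z x; first exact: concl E ux hz zx.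
- apply: (concl _ _ (- x) (- z) (PL_embedding_reflect_target E)); last by lra.
  + by rewrite /= opprK => /oppr_inj.
  + by rewrite /= opprK hz.
- have a0c' : a0 <= c' by lra.
  have d'b0 : d' <= b0 by lra.
  have [z0 z0x uz0] := phi_double_commutator_fixes_below Pg E x a0c' d'b0 uD.
  have [b [_ bx ub um]] := last_fixed_point uz0 z0x ux.
  exfalso; apply: (phi_double_commutator_wanders Pg E a0c' d'b0 Gh
    (or_introl hdc) uD ub um (x := x)); first by rewrite bx lexx.
  by rewrite -zx hz zx bx lexx.
Qed.

End SlopeTransfer.

(** * Steinitz exchange in arbitrary cardinality *)

Section Exchange.
Variables (K : fieldType) (V : lmodType K) (I : choiceType).
Implicit Types (C : set I) (B : set V) (e h : I -> V) (s : seq I) (u v : V).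

Definition indep_family C h := forall s (c : I -> K), uniq s -> [set` s] `<=` C ->
  \sum_(i <- s) c i *: h i = 0 -> {in s, forall i, c i = 0}.

Definition in_span C h v := exists s (c : I -> K),
  [/\ uniq s, [set` s] `<=` C & v = \sum_(i <- s) c i *: h i].

(** Allows sums over different supports to be added. *)
Lemma sum_extend s s' (c : I -> K) h : uniq s -> uniq s' -> {subset s <= s'} ->
  \sum_(i <- s) c i *: h i = \sum_(i <- s') (if i \in s then c i else 0) *: h i.
Proof.
move=> us us' ss'.
have ps : perm_eq s [seq i <- s' | i \in s].
  apply: uniq_perm; rewrite ?filter_uniq // => i.
  by rewrite mem_filter andb_idr //; exact: ss'.
rewrite (perm_big _ ps) big_filter big_mkcond; apply: eq_bigr => i _.
by case: ifP => // _; rewrite scale0r.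
Qed.

Lemma in_spanD C h u v : in_span C h u -> in_span C h v -> in_span C h (u + v).
Proof.
move=> [s1 [c1 [u1 C1 ->]]] [s2 [c2 [u2 C2 ->]]].
pose s := undup (s1 ++ s2).
have us : uniq s by exact: undup_uniq.
exists s, (fun i => (if i \in s1 then c1 i else 0) + (if i \in s2 then c2 i else 0)).
split=> //.
  by move=> i /=; rewrite mem_undup mem_cat => /orP[/C1|/C2].
rewrite (sum_extend _ _ u1 us); last by move=> i; rewrite mem_undup mem_cat => ->.
rewrite (sum_extend _ _ u2 us); last by move=> i; rewrite mem_undup mem_cat orbC => ->.
by rewrite -big_split /=; apply: eq_bigr => i _; rewrite scalerDl.
Qed.

Lemma in_spanZ C h a v : in_span C h v -> in_span C h (a *: v).
Proof.
move=> [s [c [us Cs ->]]]; exists s, (fun i => a * c i); split=> //.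
by rewrite scaler_sumr; apply: eq_bigr => i _; rewrite scalerA.
Qed.

Lemma in_span0 C h : in_span C h 0.
Proof. by exists [::], (fun=> 0); split=> //; rewrite big_nil. Qed.

(** [G] is the graph of a partial function, giving the new values of the entries
    that are replaced.  As a set it is ordered by inclusion, the order in which
    maximal replacements are sought. *)
Definition replaced (G : set (I * V)) e i v :=
  G (i, v) \/ (~ (exists v', G (i, v'))) /\ v = e i.

Definition valid_replacement C B e (G : set (I * V)) :=
  [/\ forall i v, G (i, v) -> C i /\ B v,
      forall i v v', G (i, v) -> G (i, v') -> v = v' &
      forall h, (forall i, C i -> replaced G e i (h i)) -> indep_family C h].

Lemma replaced_exists G e : exists h, forall i, replaced G e i (h i).
Proof.
have H i : exists v, replaced G e i v.
  by have [[v Gv]|nG] := pselect (exists v, G (i, v)); [exists v; left|exists (e i); right].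
by have [h Hh] := choice H; exists h.
Qed.

(** Independence involves finitely many entries at a time, so it passes to the
    union of a chain of partial replacements. *)
Lemma valid_replacement_bigcup C B e (F : set (set (I * V))) : indep_family C e ->
  F `<=` valid_replacement C B e -> total_on F subset ->
  valid_replacement C B e (\bigcup_(X in F) X).
Proof.
move=> eI Fv Ft; set G := \bigcup_(X in F) X.
have v0 : valid_replacement C B e set0.
  split=> // h hE s c us sC sum0; apply: eI => //.
  rewrite -[RHS]sum0; apply: eq_big_seq => i /sC Ci.
  by have [[]|[_ ->]] := hE i Ci.
have Gf i v v' : G (i, v) -> G (i, v') -> v = v'.
  move=> [X FX Xv] [Y FY Yv]; have [XY|YX] := Ft X Y FX FY.
    by have [_ H _] := Fv Y FY; apply: (H i) => //; exact: XY.
  by have [_ H _] := Fv X FX; apply: (H i) => //; exact: YX.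
split=> //.
- by move=> i v [X FX Xv]; have [H _ _] := Fv X FX; exact: H.
- move=> h hE s c us sC sum0.
  have [X [Xv XG Xs]] : exists X, [/\ valid_replacement C B e X, X `<=` G &
      forall i, i \in s -> G (i, h i) -> X (i, h i)].
    have sub X : F X \/ X = set0 -> valid_replacement C B e X /\ X `<=` G.
      by move=> [FX|->]; split=> //; [exact: Fv|move=> p Xp; exists X].
    suff [X FX Xs] : exists2 X, F X \/ X = set0 &
        forall i, i \in s -> G (i, h i) -> X (i, h i).
      by exists X; have [? ?] := sub X FX; split.
    elim: (s) => [|i t [X FX Xt]]; first by exists set0; [right|].
    have [[Y FY Yi]|nG] := pselect (G (i, h i)); last first.
      by exists X => // j; rewrite inE => /orP[/eqP->|] //; exact: Xt.
    have [XY|YX] : X `<=` Y \/ Y `<=` X.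
      case: FX => [FX|->]; last by left.
      exact: Ft.
    + exists Y; first by left.
      by move=> j; rewrite inE => /orP[/eqP->|jt Gj] //; apply/XY/Xt.
    + exists X => // j; rewrite inE => /orP[/eqP->|jt Gj]; first by move=> _; exact: YX.
      exact: Xt.
  have [k kE] := replaced_exists X e.
  have [_ _ Xind] := Xv.
  apply: (Xind (fun i => if i \in s then h i else k i)) => //.
    move=> i Ci; case: ifP => // si.
    have [Gi|[nG ->]] := hE i Ci; first by left; exact: Xs.
    by right; split=> // -[v /XG Gv]; apply: nG; exists v.
  by rewrite -[RHS]sum0; apply: eq_big_seq => i ->.
Qed.

(** The Steinitz exchange lemma in arbitrary cardinality, by Zorn's lemma on
    the ways of replacing members of the independent family by members of the
    spanning set while keeping the family independent.  If some [e i] were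
    still there in a maximal replacement, each element of [B] would lie in the
    span of the other members, and so would [e i]. *)
Theorem independent_injects_into_spanning C B e : indep_family C e -> spanning B ->
  exists f : I -> V, (forall i, C i -> B (f i)) /\
    forall i j, C i -> C j -> f i = f j -> i = j.
Proof.
move=> eI Bsp.
have [G [[GCB Gf Gind] Gmax]] := Zorn_bigcup (fun F => @valid_replacement_bigcup C B e F eI).
have [h hE] := replaced_exists G e.
have hI : indep_family C h by apply: Gind.
suff tot i : C i -> exists v, G (i, v).
  exists h; split.
    move=> i Ci; have [/GCB[]//|[nG _]] := hE i.
    by case: nG; exact: tot.
  move=> i j Ci Cj hij; apply/eqP; apply: contrapT => /negP ij.
  have ij' := negbTE ij.
  have := hI [:: i; j] (fun k => if k == i then 1 else -1).
  rewrite /= inE ij' => /(_ isT) H.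
  have /H{}H : [set` [:: i; j]] `<=` C.
    by move=> k /=; rewrite !inE => /orP[] /eqP ->.
  have {H} := fun sum0 => H sum0 i.
  rewrite !big_cons big_nil eqxx eq_sym ij' hij scale1r scaleN1r addr0 subrr.
  by move=> /(_ erefl); rewrite inE eqxx => /(_ isT)/eqP; rewrite oner_eq0.
move=> Ci; apply: contrapT => nG.
have hi : h i = e i.
  by have [Gi|[_ //]] := hE i; case: nG; exists (h i).
pose D := C `\ i.
have Bspan b : B b -> in_span D h b.
  move=> Bb; apply: contrapT => nb.
  pose G' : set (I * V) := G `|` [set (i, b)].
  apply: (Gmax G').
    split; first by move=> p Gp; left.
    by move=> GG; apply: nG; exists b; apply: GG; right.
  split.
  - by move=> j v [/GCB//|[-> ->]].
  - move=> j v v' [Gv|[jE vE]] [Gv'|[jE' vE']].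
    + exact: Gf Gv Gv'.
    + by case: nG; exists v; rewrite -jE'.
    + by case: nG; exists v'; rewrite -jE.
    + by rewrite vE vE'.
  - move=> k kE s c us sC sum0.
    have ki : k i = b.
      have [[Gk|[//]]|[nG' _]] := kE i Ci; first by case: nG; exists (k i).
      by case: nG'; exists b; right.
    have kj j : C j -> j != i -> k j = h j.
      move=> Cj ji; have [[Gj|[jE _]]|[nj ->]] := kE j Cj.
      + have [Gh|[ng _]] := hE j; first exact: Gf Gj Gh.
        by case: ng; exists (k j).
      + by move: ji; rewrite jE eqxx.
      + by have [Gh|[_ ->//]] := hE j; case: nj; exists (h j); left.
    have [si|si] := boolP (i \in s); last first.
      apply: hI => //; rewrite -[RHS]sum0; apply: eq_big_seq => j js.
      by rewrite kj //; [exact: sC|apply: contraNneq si => <-].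
    have rD j : j \in rem i s -> C j /\ j != i.
      by rewrite mem_rem_uniq // inE => /andP[ji js]; split=> //; exact: sC.
    have ur : uniq (rem i s) by exact: rem_uniq.
    have E : \sum_(j <- rem i s) c j *: k j = \sum_(j <- rem i s) c j *: h j.
      by apply: eq_big_seq => j /rD[Cj ji]; rewrite kj.
    move: sum0; rewrite (big_rem i) //= ki E => sum0.
    have [ci0|ci0] := eqVneq (c i) 0.
      move: sum0; rewrite ci0 scale0r add0r => sum0 j js.
      have [->//|ji] := eqVneq j i.
      apply: (hI (rem i s)) => //; first by move=> l /= /rD[].
      by rewrite mem_rem_uniq // inE ji.
    case: nb; exists (rem i s), (fun j => - (c j / c i)); split=> //.
      by move=> j /= /rD[Cj /eqP ji].
    have -> : b = - ((c i)^-1 *: \sum_(j <- rem i s) c j *: h j).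
      rewrite -scalerN; apply: (scalerI ci0).
      by rewrite scalerA mulfV // scale1r; apply/eqP; rewrite -addr_eq0 sum0.
    rewrite scaler_sumr -sumrN; apply: eq_bigr => j _.
    by rewrite scalerA -scaleNr mulrC.
have [s [c [sB eE]]] := Bsp (e i).
have [t [d [ut tD eE']]] : in_span D h (e i).
  rewrite eE; elim: s sB {eE} => [|b s IH] sB; first by rewrite big_nil; exact: in_span0.
  rewrite big_cons; apply: in_spanD.
    by apply/in_spanZ/Bspan/sB; rewrite /= inE eqxx.
  by apply: IH => j js; apply: sB; rewrite /= inE js orbT.
have it : i \notin t by apply/negP => /tD[_]; exact.
have := hI (i :: t) (fun j => if j == i then -1 else d j).
rewrite /= it ut => /(_ isT) H.
have /H{}H : [set` i :: t] `<=` C.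
  by move=> j /=; rewrite inE => /orP[/eqP->//|/tD[]].
have {H} := fun sum0 => H sum0 i.
rewrite big_cons eqxx hi scaleN1r {1}eE' inE eqxx.
have -> : \sum_(j <- t) (if j == i then -1 else d j) *: h j = \sum_(j <- t) d j *: h j.
  by apply: eq_big_seq => j jt; rewrite ifN //; apply: contraNneq it => <-.
by rewrite addNr => /(_ erefl isT)/eqP; rewrite oppr_eq0 oner_eq0.
Qed.

End Exchange.

(** * Tensor products with the rationals *)

Section RationalLine.
Variable R : realType.

(** The target of the logarithm, as a homomorphism from a multiplicative group
    to a rational vector space. *)
Definition rational_line : Type := R.
HB.instance Definition _ := GRing.Zmodule.on rational_line.

Definition rational_scale (q : rat) (x : rational_line) : rational_line :=
  (ratr q : R) * (x : R).

Fact rational_scaleA a b v :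
  rational_scale a (rational_scale b v) = rational_scale (a * b) v.
Proof. by rewrite /rational_scale rmorphM mulrA. Qed.

Fact rational_scale1 : left_id 1 rational_scale.
Proof. by move=> v; rewrite /rational_scale rmorph1 mul1r. Qed.

Fact rational_scaleDr : right_distributive rational_scale +%R.
Proof. by move=> a u v; rewrite /rational_scale mulrDr. Qed.

Fact rational_scaleDl v : {morph rational_scale^~ v : a b / a + b}.
Proof. by move=> a b; rewrite /rational_scale rmorphD mulrDl. Qed.

HB.instance Definition _ := GRing.Zmodule_isLmodule.Build rat rational_line
  rational_scaleA rational_scale1 rational_scaleDr rational_scaleDl.

End RationalLine.

Section Tensor.
Variable R : realType.
Implicit Types (P Q : set R) (x y : R).

Lemma mul_to_add1 P (V : zmodType) (i : R -> V) : pos_subgroup P ->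
  mul_to_add P i -> i 1 = 0.
Proof.
move=> Pg iM; have P1 : 1 \in P by apply/in_setP; exact: pos_subgroup1.
by have := iM 1 1 P1 P1; rewrite mulr1 => /eqP; rewrite -subr_eq0 opprD addNKr oppr_eq0 => /eqP.
Qed.

Lemma mul_to_addV P (V : zmodType) (i : R -> V) x : pos_subgroup P ->
  mul_to_add P i -> P x -> i x^-1 = - i x.
Proof.
move=> Pg iM Px; apply/eqP; rewrite -addr_eq0 -iM; last 2 first.
- by apply/in_setP; exact: pos_subgroupV.
- exact/in_setP.
by rewrite mulVf ?(mul_to_add1 Pg iM) // gt_eqF // (pos_subgroup_gt0 Pg Px).
Qed.

Lemma pos_subgroupXz P x (z : int) : pos_subgroup P -> P x -> P (x ^ z).
Proof.
by move=> Pg Px; case: z => n; [|apply: pos_subgroupV => //]; exact: pos_subgroupX.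
Qed.

Lemma mul_to_addXz P (V : lmodType rat) (i : R -> V) x (z : int) : pos_subgroup P ->
  mul_to_add P i -> P x -> i (x ^ z) = z%:~R *: i x.
Proof.
move=> Pg iM Px.
have X n : i (x ^+ n) = n%:R *: i x.
  elim: n => [|n IH]; first by rewrite expr0 (mul_to_add1 Pg iM) scale0r.
  rewrite exprS iM ?IH; [|exact/in_setP|by apply/in_setP; exact: pos_subgroupX].
  by rewrite -natr1 addrC scalerDl scale1r.
case: z => n; first exact: X.
by rewrite NegzE /exprz (mul_to_addV Pg iM) ?X ?mulrNz ?scaleNr //; exact: pos_subgroupX.
Qed.

Lemma ln_mul_to_add P : pos_subgroup P -> mul_to_add P (@ln R : R -> rational_line R).
Proof.
move=> Pg x y /in_setP/(pos_subgroup_gt0 Pg) x0 /in_setP/(pos_subgroup_gt0 Pg) y0.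
exact: lnM.
Qed.

(** The logarithm embeds a group of positive reals into a rational vector
    space; hence its map to the tensor product is injective. *)
Lemma tensor_rat_injective P (V : lmodType rat) (i : R -> V) x : pos_subgroup P ->
  is_tensor_rat P i -> P x -> i x = 0 -> x = 1.
Proof.
move=> Pg [iM iU] Px ix.
have [g [gE _]] := iU _ _ (ln_mul_to_add Pg).
have := gE x ((in_setP P x).2 Px); rewrite ix linear0 => lnx.
apply: ln_inj; rewrite ?posrE //; first exact: (pos_subgroup_gt0 Pg Px).
by rewrite ln1 -lnx.
Qed.

End Tensor.

Section TensorGenerators.
Variables (R : realType) (P : set R) (W : lmodType rat) (j : R -> W).
Hypotheses (Pg : pos_subgroup P) (jM : mul_to_add P j).

Definition divides_image : {pred W} :=
  fun w => `[< exists z : int, z != 0 /\ exists2 x, P x & z%:~R *: w = j x >].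

Lemma divides_imageP w : w \in divides_image <->
  exists z : int, z != 0 /\ exists2 x, P x & z%:~R *: w = j x.
Proof. by split=> /asboolP. Qed.

Lemma divides_image_submod : submod_closed divides_image.
Proof.
split.
  apply/divides_imageP; exists 1; split=> //; exists 1; first exact: pos_subgroup1.
  by rewrite (mul_to_add1 Pg jM) scaler0.
move=> a u v /divides_imageP[z [z0 [x Px zu]]] /divides_imageP[t [t0 [y Py tv]]].
apply/divides_imageP; exists (denq a * z * t); split.
  by rewrite !mulf_neq0 ?denq_neq0.
exists (x ^ (numq a * t) * y ^ (denq a * z)).
  by apply: pos_subgroupM => //; exact: pos_subgroupXz.
rewrite jM; try (by apply/in_setP; exact: pos_subgroupXz).
rewrite !(mul_to_addXz _ Pg jM) // -zu -tv !scalerA scalerDr scalerA.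
have aE : (denq a)%:~R * a = (numq a)%:~R.
  by rewrite -[in X in _ * X](divq_num_den a) mulrC divfK // intr_eq0 denq_neq0.
congr (_ *: _ + _ *: _); rewrite !intrM; last ring.
by rewrite -aE; ring.
Qed.

HB.instance Definition _ :=
  GRing.isSubmodClosed.Build rat W divides_image divides_image_submod.

Record divides_image_type :=
  DividesImage {divides_image_val :> W; _ : divides_image_val \in divides_image}.
HB.instance Definition _ := [isSub for divides_image_val].
HB.instance Definition _ := [Choice of divides_image_type by <:].
HB.instance Definition _ := [SubChoice_isSubLmodule of divides_image_type by <:].

(** The elements with a multiple in the image of [j] form a subspace through
    which [j] factors, so by uniqueness it is everything. *)
Lemma tensor_rat_divides w : is_tensor_rat P j -> w \in divides_image.
Proof.
move=> [_ jU].
have jD x : P x -> j x \in divides_image.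
  by move=> Px; apply/divides_imageP; exists 1; split=> //; exists x => //; rewrite scale1r.
pose j' x : divides_image_type := insubd (0 : divides_image_type) (j x).
have j'E x : P x -> \val (j' x) = j x by move=> /jD jx; rewrite /j' insubdK.
have j'M : mul_to_add P j'.
  move=> x y /in_setP Px /in_setP Py; apply: val_inj; rewrite raddfD /= !j'E //.
    by apply: jM; exact/in_setP.
  exact: pos_subgroupM.
have [g [gE _]] := jU _ _ j'M.
have [h [hE hU]] := jU W j jM.
have lin : linear (fun w => \val (g w) : W) by move=> a u v; rewrite !linearP.
pose vg := HB.pack_for {linear W -> W} (fun w => \val (g w) : W)
  (GRing.isLinear.Build _ _ _ _ _ lin).
have vgE : vg =1 h by apply: hU => x Px; rewrite /= gE // j'E //; exact/in_setP.
have idE : (idfun : W -> W) =1 h by apply: (hU (idfun : {linear W -> W})).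
have -> : w = \val (g w) by rewrite -[RHS]/(vg w) vgE -idE.
exact: valP.
Qed.

End TensorGenerators.

Section AbelianRank.
Variable R : realType.
Implicit Types (P Q : set R).

Lemma injective_hom1 P Q chi : pos_subgroup P -> pos_subgroup Q ->
  injective_hom P Q chi -> chi 1 = 1.
Proof.
move=> Pg Qg [chiQ chiM _]; have P1 := pos_subgroup1 Pg.
have chi0 : chi 1 != 0 by rewrite gt_eqF // (pos_subgroup_gt0 Qg (chiQ 1 P1)).
by apply: (mulfI chi0); rewrite -chiM // !mulr1.
Qed.

(** The homomorphism induces a linear map between the tensor products.  Each
    vector of its source has a nonzero multiple in the image of [P], and the
    image of [Q] in the target is faithful, so this map is injective.  It maps a
    basis to an independent family, which injects into a basis of the target. *)
Theorem injective_hom_abelian_rank P Q chi : pos_subgroup P -> pos_subgroup Q ->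
  injective_hom P Q chi -> ~ abelian_rank_lt Q P.
Proof.
move=> Pg Qg chiH; have [chiQ chiM chiI] := chiH.
move=> [V [W [i [j [iT jT [B [C [Bb [Cind _] _ nCB]]]]]]]].
apply: nCB.
have [iM _] := iT; have [jM jU] := jT.
have hM : mul_to_add P (i \o chi).
  move=> x y /in_setP Px /in_setP Py; rewrite /= chiM // iM //; exact/in_setP/chiQ.
have [g [gE _]] := jU _ _ hM.
have P1 := pos_subgroup1 Pg; have chi1 := injective_hom1 Pg Qg chiH.
have gI w : g w = 0 -> w = 0.
  move=> gw; have /divides_imageP[z [z0 [x Px zw]]] := tensor_rat_divides Pg jM w jT.
  have ix : i (chi x) = 0.
    by rewrite -[LHS](gE x ((in_setP P x).2 Px)) -zw linearZ /= gw scaler0.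
  have x1 : x = 1.
    by apply: chiI => //; rewrite chi1; exact: (tensor_rat_injective Qg iT (chiQ x Px)).
  have z0' : z%:~R != 0 :> rat by rewrite intr_eq0.
  by apply: (scalerI z0'); rewrite zw x1 (mul_to_add1 Pg jM) scaler0.
have gind : indep_family C g.
  move=> s c us sC sum0; apply: (Cind s c us sC); apply: gI.
  by rewrite linear_sum -[RHS]sum0; apply: eq_bigr => w _; rewrite linearZ.
have [f [fB fI]] := independent_injects_into_spanning gind Bb.2.
have fI' : {in C &, injective f} by move=> u v; rewrite !in_setE; exact: fI.
rewrite -(card_le_eql (inj_card_eq fI')); apply: subset_card_le.
by move=> _ [u Cu <-]; exact: fB.
Qed.

End AbelianRank.

(** * Homeomorphisms of the unit interval *)

Section UnitInterval.
Variable R : realType.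
Local Notation hR := (homeo R).
Local Notation UI := (unit_interval R).
Implicit Types (x y z a b c d s t : R) (u v w : UI) (f g : hR) (h k : homeo UI) (P A : set R).

Lemma set_val_continuous : continuous (set_val : UI -> R).
Proof. exact: (@initial_continuous (set_type (`[0, 1]%classic : set R)) R set_val). Qed.

(** Neighbourhoods in the subspace topology, one-sided at 0 and 1. *)
Lemma nearUI u (Q : UI -> Prop) :
  (\forall v \near u, Q v) <->
  exists2 d, 0 < d & forall v, set_val u - d < set_val v ->
    set_val v < set_val u + d -> Q v.
Proof.
split.
- move=> [_ [/= [W oW <-] /= Wu WQ]].
  have /nearR[d d0 Hd] : nbhs (set_val u : R) W by exact: open_nbhs_nbhs.
  by exists d => // v v1 v2; apply: WQ; exact: Hd.
- move=> [d d0 Hd].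
  have N : \forall y \near (set_val u : R), set_val u - d < y /\ y < set_val u + d.
    by apply/nearR; exists d.
  near=> v; have [v1 v2] : set_val u - d < set_val v /\ set_val v < set_val u + d.
    by near: v; exact: set_val_continuous N.
  exact: Hd.
Unshelve. all: by end_near.
Qed.

Lemma set_val_UI u : 0 <= (set_val u : R) <= 1.
Proof. by have := set_valP u; rewrite /= in_itv. Qed.

Lemma clamp_subproof x : Num.max 0 (Num.min x 1) \in (`[0, 1]%classic : set R).
Proof.
by apply: mem_set; rewrite /= in_itv /= le_max lexx ge_max ler01 ge_min lexx orbT.
Qed.

(** A retraction of the line onto the unit interval, total so that restrictions
    can be defined without carrying proofs of membership. *)
Definition clamp x : UI :=
  exist (fun y : R => y \in (`[0, 1]%classic : set R)) _ (clamp_subproof x).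

Lemma set_val_clamp x : 0 <= x <= 1 -> set_val (clamp x) = x.
Proof. by move=> /andP[x0 x1]; rewrite /= set_valE /= min_l // max_r. Qed.

Lemma set_val_inj : injective (set_val : UI -> R).
Proof. exact: val_inj. Qed.

Lemma clampK u : clamp (set_val u) = u.
Proof. by apply: set_val_inj; rewrite set_val_clamp // set_val_UI. Qed.

Definition preserves_UI (f : R -> R) := forall x, 0 <= x <= 1 -> 0 <= f x <= 1.

Section Restriction.
Variable f : hR.
Hypotheses (fU : preserves_UI f) (fVU : preserves_UI (f^-1)%g).

Let restr (g : R -> R) u := clamp (g (set_val u)).

Let restrE g u : preserves_UI g -> set_val (restr g u) = g (set_val u).
Proof. by move=> gU; rewrite set_val_clamp //; apply: gU; exact: set_val_UI. Qed.

Let restrK : cancel (restr f) (restr (f^-1)%g).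
Proof. by move=> u; apply: set_val_inj; rewrite !restrE // homeoVK. Qed.

Let restrVK : cancel (restr (f^-1)%g) (restr f).
Proof. by move=> u; apply: set_val_inj; rewrite !restrE // homeoKV. Qed.

Let restr_continuous (g : hR) : preserves_UI g -> continuous (restr g).
Proof.
move=> gU; apply: continuous_comp_initial.
have -> : set_val \o restr g = g \o (set_val : UI -> R).
  by apply/funext => u /=; rewrite restrE.
move=> u; apply: continuous_comp; first exact: set_val_continuous.
exact: homeo_continuous.
Qed.

Definition restrict_UI : homeo UI :=
  Homeo restrK restrVK (restr_continuous fU) (restr_continuous fVU).

Lemma restrict_UIE u : set_val (restrict_UI u) = f (set_val u).
Proof. exact: restrE. Qed.

End Restriction.

(** The default value makes this a function on all homeomorphisms of the line,
    which can be composed with an embedding. *)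
Definition restrict f : homeo UI :=
  match pselect (preserves_UI f /\ preserves_UI (f^-1)%g) with
  | left H => restrict_UI H.1 H.2
  | right _ => 1%g
  end.

Lemma restrictE f u : preserves_UI f -> preserves_UI (f^-1)%g ->
  set_val (restrict f u) = f (set_val u).
Proof.
move=> fU fVU; rewrite /restrict; case: pselect => [H|[]//].
exact: restrict_UIE.
Qed.

Definition increasing_UI h :=
  forall u v, (set_val u : R) < set_val v -> (set_val (h u) : R) < set_val (h v).

Definition extend_fun h x : R :=
  if (0 <= x <= 1) then set_val (h (clamp x)) else x.

Lemma extend_fun_increasing h : increasing_UI h -> increasing (extend_fun h).
Proof.
move=> hi x y xy; rewrite /extend_fun.
have := set_val_UI (h (clamp x)); have := set_val_UI (h (clamp y)).
case: ifP => xI; case: ifP => yI; try lra.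
by move=> _ _; apply: hi; rewrite !set_val_clamp.
Qed.

Lemma extend_funK h : cancel (extend_fun h) (extend_fun (h^-1)%g).
Proof.
move=> x; rewrite {2}/extend_fun; case: ifP => xI; last by rewrite /extend_fun xI.
rewrite /extend_fun set_val_UI clampK.
have -> : (h^-1)%g (h (clamp x)) = clamp x by exact: homeo_funK.
by rewrite set_val_clamp.
Qed.

Lemma extend_funVK h : cancel (extend_fun (h^-1)%g) (extend_fun h).
Proof. by have := extend_funK (h^-1)%g; rewrite invgK. Qed.

(** The default value has the same purpose as for [restrict]. *)
Definition extend h : hR :=
  match pselect (increasing_UI h) with
  | left H => increasing_homeo (extend_fun_increasing H) (extend_funK h) (extend_funVK h)
  | right _ => 1%g
  end.

Lemma extendE h x : increasing_UI h -> extend h x = extend_fun h x.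
Proof. by move=> hi; rewrite /extend; case: pselect. Qed.

Lemma extendM h k : increasing_UI h -> increasing_UI k ->
  extend (h * k)%g = (extend h * extend k)%g.
Proof.
move=> hi ki; apply: homeo_ext => x.
rewrite homeoME !extendE //; last by move=> u v uv; apply/hi/ki.
rewrite /extend_fun; case: ifP => xI; last by rewrite xI.
by rewrite set_val_UI clampK.
Qed.

Lemma extend_inj h k : increasing_UI h -> increasing_UI k ->
  extend h = extend k -> h = k.
Proof.
move=> hi ki hk; apply: homeo_ext => u; apply: set_val_inj.
have := congr1 (fun f : hR => f (set_val u)) hk.
by rewrite /= !extendE // /extend_fun set_val_UI clampK.
Qed.

Lemma extend_has_slope h u s : increasing_UI h -> 0 < (set_val u : R) < 1 ->
  has_slope idfun (extend h) (set_val u) s <-> has_slope (set_val : UI -> R) h u s.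
Proof.
move=> hi u01.
have eE v : extend h (set_val v) = set_val (h v).
  by rewrite extendE // /extend_fun set_val_UI clampK.
split.
- move=> /has_slopeP[d d0 Hd]; apply/nearUI; exists d => // v v1 v2.
  by have := Hd _ v1 v2; rewrite !eE.
- move=> /nearUI[d d0 Hd]; apply/has_slopeP.
  exists (Num.min d (Num.min (set_val u) (1 - set_val u))).
    by rewrite !lt_min; lra.
  move=> y; rewrite ltrBlDr -ltrBlDl -ltrBlDl !lt_min => y1 y2.
  have yE : y = set_val (clamp y) by rewrite set_val_clamp //; lra.
  by rewrite yE !eE; apply: Hd; rewrite -yE; lra.
Qed.

(** The breakpoints of the extension lie over those of [h] or are 0 or 1.  At 0
    and 1 a slope can only be 1, the slope on the outer side. *)
Lemma extend_PL h P B : P 1 -> PL_homeos (set_val : UI -> R) P B h ->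
  PL_homeos idfun P setT (extend h).
Proof.
move=> P1 [hi fin Ps _]; have hi' : increasing_UI h by exact: hi.
have out x : ~ (0 <= x <= 1) -> has_slope idfun (extend h) x 1.
  have outE y : ~ (0 <= y <= 1) -> extend h y = y.
    by move=> nI; rewrite extendE // /extend_fun ifN //; apply/negP.
  move=> nI; apply/has_slopeP; have [x0|x0] := ltP x 0.
    by exists (- x); [lra|move=> y ? ?; rewrite !outE; lra].
  by exists (x - 1); [lra|move=> y ? ?; rewrite !outE; lra].
have inE x : 0 < x < 1 -> x = set_val (clamp x).
  by move=> x01; rewrite set_val_clamp //; lra.
split=> //.
- by move=> x y xy; rewrite /= !extendE //; exact: extend_fun_increasing.
- apply: (@sub_finite_set _ _ ([set 0; 1] `|`
      set_val @` breakpoints (set_val : UI -> R) h)); last first.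
    by rewrite finite_setU; split; [exact: finite_set2|exact: finite_image].
  move=> x bx; have [x01|x01] := boolP (0 < x < 1).
    right; exists (clamp x); last by rewrite -inE.
    move=> [s hs]; apply: bx; exists s.
    by rewrite (inE x x01); apply/extend_has_slope; rewrite // -inE.
  left; apply: contrapT => n01; apply: bx; exists 1; apply: out => xI; apply: n01 => /=.
  have [->|x0] := eqVneq x 0; first by left.
  by right; apply/eqP; move: x0 x01; lra.
- move=> x s xs; have [x01|x01] := boolP (0 < x < 1).
    apply: (Ps (clamp x)); apply/(extend_has_slope _ hi'); rewrite -inE //.
  have /nearR[d d0 Hd] := has_slope_near xs.
  have [y [y1 y2 nI]] : exists y, [/\ x - d < y, y < x + d & ~ (0 <= y <= 1)].
    have [x0|x0] := leP x 0; first by exists (x - d / 2); split; lra.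
    exists (x + d / 2); split; lra.
  by rewrite (has_slope_uniq (Hd y y1 y2) (out y nI)).
Qed.

Lemma BS_preserves_UI A P a b f : 0 < a -> b < 1 ->
  BieriStrebel `[a, b]%classic A P f -> preserves_UI f.
Proof.
move=> a0 b1 Bf x xI; have [fx|/eqP fx] := eqVneq (f x) x; first by rewrite fx.
have := BS_supportP Bf (x := f x); move=> H.
have : a <= f x <= b by apply: H => /homeo_inj.
lra.
Qed.

(** The support stays away from 0 and 1, so that no breakpoint is at an end. *)
Lemma restrict_BrownSteinThompson A P a b f : pos_subgroup P -> 0 < a -> b < 1 ->
  BieriStrebel `[a, b]%classic A P f ->
  PL_homeos (set_val : UI -> R) P (A `&` `]0, 1[%classic) (restrict f).
Proof.
move=> Pg a0 b1 Bf.
have fU := BS_preserves_UI a0 b1 Bf.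
have fVU := BS_preserves_UI a0 b1 (BieriStrebelV Pg Bf).
have rE u : set_val (restrict f u) = f (set_val u) by exact: restrictE.
have [[fi fin Ps BA] _ _] := (BieriStrebelP _ _ _ _).1 Bf.
have slp u s : has_slope idfun f (set_val u) s ->
    has_slope (set_val : UI -> R) (restrict f) u s.
  move=> /has_slopeP[d d0 Hd]; apply/nearUI; exists d => // v v1 v2.
  by rewrite !rE Hd.
have bpf u : breakpoints (set_val : UI -> R) (restrict f) u ->
    breakpoints idfun f (set_val u).
  by move=> + [s us]; apply; exists s; exact: slp.
have bpI x : breakpoints idfun f x -> a <= x <= b.
  move=> bx; apply: contrapT => nI; apply: bx; exists 1; apply/has_slopeP.
  have [xa|ax] := ltP x a.
    by exists (a - x); [lra|move=> y ? ?; rewrite !(BS_fix Bf); lra].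
  by exists (x - b); [lra|move=> y ? ?; rewrite !(BS_fix Bf); lra].
split.
- by move=> u v uv; rewrite !rE; exact: fi.
- apply: (@sub_finite_set _ _ (clamp @` breakpoints idfun f)).
    by move=> u /bpf bu; exists (set_val u) => //; exact: clampK.
  exact: finite_image.
- move=> u s /has_slope_near/nearUI[d d0 Hd].
  (* at an end of the interval the slope is that of nearby inner points *)
  have uI := set_val_UI u.
  have [x [x1 x2 x01]] : exists x, [/\ set_val u - d < x, x < set_val u + d & 0 < x < 1].
    have [u1|u1] := leP (1 / 2) (set_val u : R).
      by exists (Num.max (1 / 4) (set_val u - d / 2)); split;
         rewrite ?lt_max ?gt_max; lra.
    by exists (Num.min (3 / 4) (set_val u + d / 2)); split;
       rewrite ?lt_min ?gt_min; lra.
  have xE : x = set_val (clamp x) by rewrite set_val_clamp //; lra.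
  have {Hd} /nearUI[e e0 He] : has_slope (set_val : UI -> R) (restrict f) (clamp x) s.
    by apply: Hd; rewrite -xE.
  apply: (Ps x); apply/has_slopeP; exists (Num.min e (Num.min x (1 - x))).
    by rewrite !lt_min; lra.
  move=> y; rewrite ltrBlDr -ltrBlDl -ltrBlDl !lt_min => y1 y2.
  have yE : y = set_val (clamp y) by rewrite set_val_clamp //; lra.
  have := He (clamp y); rewrite !rE -xE -yE; apply; lra.
- move=> _ [u /bpf bu <-]; split; first by apply: BA; exists (set_val u).
  by have := bpI _ bu; rewrite /= in_itv /=; lra.
Qed.

(** Elements supported away from the ends restrict to the unit interval without
    loss, and the images under [phi] extend to the line. *)
Lemma PL_embedding_of_UI a b A P Q B (phi : homeo UI -> homeo UI)
    (G H : set (homeo UI)) : pos_subgroup P -> Q 1 -> 0 < a -> b < 1 ->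
  PL_homeos (set_val : UI -> R) P (A `&` `]0, 1[%classic) `<=` G ->
  H `<=` PL_homeos (set_val : UI -> R) Q B ->
  (forall h, G h -> H (phi h)) ->
  (forall h k, G h -> G k -> phi (h * k)%g = (phi h * phi k)%g) ->
  (forall h k, G h -> G k -> phi h = phi k -> h = k) ->
  PL_embedding a b A P Q (fun f => extend (phi (restrict f))).
Proof.
move=> Pg Q1 a0 b1 PG HQ pH pM pI.
have rG f : BieriStrebel `[a, b]%classic A P f -> G (restrict f).
  by move=> /(restrict_BrownSteinThompson Pg a0 b1)/PG.
have incH h : H h -> increasing_UI h by move=> /HQ[hi _ _ _]; exact: hi.
have fU f : BieriStrebel `[a, b]%classic A P f -> preserves_UI f.
  exact: BS_preserves_UI.
have fVU f : BieriStrebel `[a, b]%classic A P f -> preserves_UI (f^-1)%g.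
  by move=> Bf; apply: (fU (f^-1)%g); exact: BieriStrebelV.
split=> [f Bf|f g Bf Bg|f g Bf Bg].
- by apply: (extend_PL Q1); apply/HQ/pH/rG.
- have -> : restrict (f * g)%g = (restrict f * restrict g)%g.
    apply: homeo_ext => u; apply: set_val_inj.
    have Bfg := BieriStrebelM Pg Bf Bg.
    rewrite (restrictE _ (fU _ Bfg) (fVU _ Bfg)) homeoME.
    by rewrite -(restrictE _ (fU _ Bg) (fVU _ Bg)) -(restrictE _ (fU _ Bf) (fVU _ Bf)).
  rewrite pM; [|exact: rG|exact: rG].
  by rewrite extendM //; apply/incH/pH/rG.
- move=> /extend_inj fg; have {}fg := pI _ _ (rG _ Bf) (rG _ Bg) (fg
    (incH _ (pH _ (rG _ Bf))) (incH _ (pH _ (rG _ Bg)))).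
  apply: homeo_ext => x; have [xI|xI] := boolP (0 <= x <= 1).
    rewrite -(set_val_clamp xI) -(restrictE _ (fU _ Bf) (fVU _ Bf)) fg.
    by rewrite (restrictE _ (fU _ Bg) (fVU _ Bg)).
  by rewrite (BS_fix Bf) ?(BS_fix Bg) //; lra.
Qed.

End UnitInterval.

(** * Prime slopes *)

Section Generated.
Variable R : realType.
Implicit Types (S P A : set R) (x y s : R).

Lemma pos_subgroup_gen_group S : S `<=` [set x | 0 < x] -> pos_subgroup (pos_subgroup_gen S).
Proof.
move=> S0; split.
  apply: smallest_sub S0; split=> //; split; first exact/in_setP/ltr01.
  by move=> x y /in_setP x0 /in_setP y0; apply/in_setP; exact: divr_gt0.
split; first by apply/in_setP => P [/pos_subgroup1].
move=> x y /in_setP Gx /in_setP Gy; apply/in_setP => P PS.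
by apply: pos_subgroup_div; [case: PS|exact: Gx|exact: Gy].
Qed.

Lemma subring_gen_subring S : subring_closed [in subring_gen S].
Proof.
split; first by apply/in_setP => A [[/in_setP]].
  move=> x y /in_setP Gx /in_setP Gy; apply/in_setP => A AS.
  by have [[_ AB _] _] := AS; apply/in_setP/AB; apply/in_setP; [exact: Gx|exact: Gy].
move=> x y /in_setP Gx /in_setP Gy; apply/in_setP => A AS.
by have [[_ _ AM] _] := AS; apply/in_setP/AM; apply/in_setP; [exact: Gx|exact: Gy].
Qed.

Lemma subring_genM S x y : subring_gen S x -> subring_gen S y -> subring_gen S (x * y).
Proof.
have [_ _ SM] := subring_gen_subring S.
by move=> /in_setP Sx /in_setP Sy; apply/in_setP; exact: SM.
Qed.

Lemma subring_genB S x y : subring_gen S x -> subring_gen S y -> subring_gen S (x - y).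
Proof.
have [_ SB _] := subring_gen_subring S.
by move=> /in_setP Sx /in_setP Sy; apply/in_setP; exact: SB.
Qed.

Lemma subring_gen1 S : subring_gen S 1.
Proof. by have [/in_setP] := subring_gen_subring S. Qed.

Lemma subring_gen_nat S n : subring_gen S n%:R.
Proof.
have S0 : subring_gen S 0 by rewrite -(subrr 1); apply: subring_genB; exact: subring_gen1.
elim: n => [|n IH] //; rewrite -natr1 -[X in _ + X]opprK; apply: subring_genB => //.
by rewrite -sub0r; apply: subring_genB => //; exact: subring_gen1.
Qed.

Variables (n : nat) (p : n.-tuple nat).
Hypothesis p_prime : all prime p.
Let P := pos_subgroup_gen [set (q%:R : R) | q in [set` p]].
Let A := subring_gen [set ((\prod_(q <- p) q)%N%:R^-1 : R)].

Let p_gt0 q : q \in p -> (0 < q)%N.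
Proof. by move=> /(allP p_prime)/prime_gt0. Qed.

Lemma prime_slopes_group : pos_subgroup P.
Proof. by apply: pos_subgroup_gen_group => _ [q /p_gt0 q0 <-] /=; rewrite ltr0n. Qed.

Lemma prime_slope q : q \in p -> P q%:R.
Proof. by move=> qp; apply: sub_gen_smallest; exists q. Qed.

(** A prime [q] of the tuple divides the product N of the tuple, so 1/q is an
    integer multiple of 1/N. *)
Lemma prime_slopes_submodule : is_submodule P A.
Proof.
have PA : P `<=` A.
  suff PT : P `<=` [set x | and3 (0 < x) (A x) (A x^-1)] by move=> x /PT[].
  apply: smallest_sub.
    split; first by move=> x [].
    split; first by apply/in_setP; split; rewrite ?invr1 //; exact: subring_gen1.
    move=> x y /in_setP[x0 Ax Ax'] /in_setP[y0 Ay Ay']; apply/in_setP; split.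
    - exact: divr_gt0.
    - exact: subring_genM.
    - by rewrite invf_div mulrC; exact: subring_genM.
  move=> _ [q qp <-]; have q0 : (0 : R) < q%:R by rewrite ltr0n p_gt0.
  split=> //; first exact: subring_gen_nat.
  have /dvdnP[k kE] : (q %| \prod_(r <- p) r)%N.
    by rewrite (big_rem q) //= dvdn_mulr.
  have N0 : (\prod_(r <- p) r)%N%:R != 0 :> R.
    by rewrite pnatr_eq0 -lt0n big_seq; apply: prodn_cond_gt0 => r; exact: p_gt0.
  have -> : (q%:R)^-1 = k%:R * (\prod_(r <- p) r)%N%:R^-1 :> R.
    move: N0; rewrite kE natrM mulf_eq0 negb_or => /andP[k0 q0'].
    by rewrite invfM mulrA mulfV // mul1r.
  by apply: subring_genM; [exact: subring_gen_nat|exact: sub_gen_smallest].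
have AP : subring_gen P `<=` A by apply: smallest_sub PA; exact: subring_gen_subring.
split; last by move=> c a /AP Ac Aa; exact: subring_genM.
split; last by move=> x y /in_setP Ax /in_setP Ay; apply/in_setP; exact: subring_genB.
by apply/in_setP; rewrite -(mulr0n 1); exact: subring_gen_nat.
Qed.

Lemma prime_slopes_products x : P x ->
  exists k : 'I_n -> int, x = \prod_i (tnth p i)%:R ^ k i.
Proof.
have p0 i : (tnth p i)%:R != 0 :> R by rewrite pnatr_eq0 -lt0n p_gt0 // mem_tnth.
have pp i (k : int) : 0 < (tnth p i)%:R ^ k :> R.
  by rewrite exprz_gt0 // ltr0n p_gt0 // mem_tnth.
suff PT : P `<=` [set x | exists k : 'I_n -> int, x = \prod_i (tnth p i)%:R ^ k i].
  exact: PT.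
apply: smallest_sub.
  split; first by move=> _ [k ->]; apply: prodr_gt0.
  split; first by apply/in_setP; exists (fun=> 0); rewrite big1.
  move=> _ _ /in_setP[k ->] /in_setP[l ->]; apply/in_setP.
  exists (fun i => k i - l i); rewrite -prodf_div.
  by apply: eq_bigr => i _; rewrite expfzDr // -invr_expz.
move=> _ [q /tnthP[i ->] <-]; exists (fun j => (j == i)%:Z).
by rewrite (bigD1 i) //= eqxx big1 ?mulr1 // => j /negbTE ->.
Qed.

End Generated.

Section PrimeRelations.

Lemma logn_prime_power_product m (q : m.-tuple nat) (a : 'I_m -> nat) j :
  uniq q -> all prime q -> logn (tnth q j) (\prod_i tnth q i ^ a i)%N = a j.
Proof.
move=> uq /all_tnthP pq.
rewrite (bigD1 j) //= lognM; last 2 first.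
- by rewrite expn_gt0 prime_gt0.
- by apply: prodn_cond_gt0 => i _; rewrite expn_gt0 prime_gt0.
rewrite pfactorK // logn_coprime ?addn0 //.
elim/big_rec: _ => [|i x ij cx]; first exact: coprimen1.
rewrite coprimeMr cx andbT coprimeXr // prime_coprime // dvdn_prime2 //.
apply: contraNneq ij => qij; apply/eqP; apply: (tuple_uniqP _ uq).
exact: esym.
Qed.

(** Unique factorization, after moving the negative powers to the other side. *)
Lemma primes_multiplicatively_independent (F : numFieldType) m (q : m.-tuple nat)
    (z : 'I_m -> int) : uniq q -> all prime q ->
  \prod_i ((tnth q i)%:R : F) ^ z i = 1 -> forall i, z i = 0.
Proof.
move=> uq pq prod1 i.
pose a j := if z j is Posz k then k else 0%N.
pose b j := if z j is Negz k then k.+1 else 0%N.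
have q0 j : (tnth q j)%:R != 0 :> F.
  by rewrite pnatr_eq0 -lt0n prime_gt0 // (all_tnthP pq).
have ab : (\prod_j tnth q j ^ a j = \prod_j tnth q j ^ b j)%N.
  apply/eqP; rewrite -(eqr_nat F) !natr_prod; apply/eqP.
  have b0 : \prod_j ((tnth q j ^ b j)%N%:R : F) != 0.
    by apply/prodf_neq0 => j _; rewrite natrX expf_neq0.
  apply: (mulIf (x := (\prod_j ((tnth q j ^ b j)%N%:R : F))^-1)); first by rewrite invr_eq0.
  rewrite mulfV // -[RHS]prod1 -prodf_div; apply: eq_bigr => j _.
  by rewrite /a /b; case: (z j) => k; rewrite !natrX expr0 ?divr1 ?div1r.
have := congr1 (logn (tnth q i)) ab; rewrite !logn_prime_power_product // /a /b.
by case: (z i) => // k ->.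
Qed.

(** More vectors than coordinates: a rational relation exists, and denominators
    can be cleared. *)
Lemma integer_relation m n (M : 'I_m -> 'I_n -> int) : (n < m)%N ->
  exists z : 'I_m -> int, (exists j, z j != 0) /\ forall i, \sum_j z j * M j i = 0.
Proof.
move=> nm; pose A : 'M[rat]_(m, n) := \matrix_(j, i) (M j i)%:~R.
pose v := nz_row (kermx A).
have v0 : v != 0.
  rewrite nz_row_eq0 -mxrank_eq0 mxrank_ker subn_eq0 -ltnNge.
  exact: leq_ltn_trans (rank_leq_col A) nm.
have vA : v *m A = 0 by apply/sub_kermxP; exact: nz_row_sub.
pose D := \prod_j denq (v 0 j).
have D0 : D != 0 by apply/prodf_neq0 => j _; rewrite denq_neq0.
pose z j := numq (v 0 j) * \prod_(k | k != j) denq (v 0 k).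
have zE j : (z j)%:~R = D%:~R * v 0 j.
  have -> : D = denq (v 0 j) * \prod_(k | k != j) denq (v 0 k) by rewrite /D (bigD1 j).
  rewrite /z !intrM [X in X * v 0 j]mulrC -mulrA mulrC; congr (_ * _).
  by rewrite -[X in _ = _ * X](divq_num_den (v 0 j)) mulrC divfK // intr_eq0 denq_neq0.
exists z; split.
  have /rV0Pn[j vj] := v0; exists j.
  by rewrite -(intr_eq0 rat) zE mulf_neq0 // intr_eq0.
move=> i; apply/eqP; rewrite -(intr_eq0 rat) rmorph_sum /=; apply/eqP.
have := congr1 (fun B : 'rV[rat]_n => D%:~R * B 0 i) vA; rewrite !mxE mulr0 => DA; rewrite -[RHS]DA.
rewrite mulr_sumr; apply: eq_bigr => j _.
by rewrite intrM zE mxE mulrA.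
Qed.

Lemma mul_to_add_prod (R : realType) (P : set R) (V : lmodType rat) (f : R -> V) m
    (x : 'I_m -> R) (z : 'I_m -> int) : pos_subgroup P -> mul_to_add P f ->
  (forall j, P (x j)) ->
  P (\prod_j x j ^ z j) /\ f (\prod_j x j ^ z j) = \sum_j (z j)%:~R *: f (x j).
Proof.
move=> Pg fM Px; elim/big_rec2: _ => [|j u v _ [Pv fv]].
  by split; [exact: pos_subgroup1|exact: (mul_to_add1 Pg fM)].
have Pj : P (x j ^ z j) by exact: pos_subgroupXz.
split; first exact: pos_subgroupM.
by rewrite fM ?(mul_to_addXz _ Pg fM) ?fv //; exact/in_setP.
Qed.

(** The images of more than [n] primes under a homomorphism to the group
    generated by [n] numbers satisfy a multiplicative relation, whereas primes
    are multiplicatively independent. *)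
Lemma no_injective_hom_primes (R : realType) m n (p : n.-tuple nat) (q : m.-tuple nat) chi :
  uniq q -> all prime p -> all prime q -> (n < m)%N ->
  ~ injective_hom (pos_subgroup_gen [set (r%:R : R) | r in [set` q]])
      (pos_subgroup_gen [set (r%:R : R) | r in [set` p]]) chi.
Proof.
move=> uq pp pq nm chiH; have [chiQ chiM chiI] := chiH.
have Pg := prime_slopes_group R pq; have Qg := prime_slopes_group R pp.
set P := pos_subgroup_gen [set r%:R | r in [set` q]] in chiQ chiM chiI Pg.
set Q := pos_subgroup_gen [set r%:R | r in [set` p]] in chiQ Qg.
have Pq j : P (tnth q j)%:R by apply: prime_slope; exact: mem_tnth.
have Qp i : Q (tnth p i)%:R by apply: prime_slope; exact: mem_tnth.
have [M HM] : exists M : 'I_m -> 'I_n -> int,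
    forall j, chi (tnth q j)%:R = \prod_i (tnth p i)%:R ^ M j i.
  have H j := prime_slopes_products pp (chiQ _ (Pq j)).
  by have [M HM] := choice H; exists M.
have [z [[j zj] Hz]] := integer_relation M nm.
have lnchi : mul_to_add P ((@ln R : R -> rational_line R) \o chi).
  move=> u v /in_setP Pu /in_setP Pv; rewrite /= chiM // (ln_mul_to_add Qg) //; apply/in_setP; exact: chiQ.
have [Px xE] := mul_to_add_prod z Pg lnchi Pq.
set x := \prod_j _ in Px xE.
have chi1 := injective_hom1 Pg Qg chiH.
suff lnx : ln (chi x) = 0.
  have x1 : x = 1.
    apply: chiI => //; first exact: pos_subgroup1.
    rewrite chi1; apply: ln_inj; rewrite ?ln1 ?posrE //.
    exact: (pos_subgroup_gt0 Qg (chiQ _ Px)).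
  by move: zj; rewrite (primes_multiplicatively_independent uq pq x1) eqxx.
rewrite [LHS]xE; under eq_bigr => k _ do
  rewrite /= HM (mul_to_add_prod (M k) Qg (ln_mul_to_add Qg) Qp).2 scaler_sumr.
rewrite exchange_big big1 //= => i _.
under eq_bigr do rewrite scalerA -intrM.
by rewrite -scaler_suml -rmorph_sum /= Hz scale0r.
Qed.

End PrimeRelations.

Theorem corollary1p8 (R : realType) :
  (forall (m n : nat) (p : n.-tuple nat) (q : m.-tuple nat),
     (2 <= m)%N -> (2 <= n)%N ->
     uniq p -> all prime p -> uniq q -> all prime q -> (n < m)%N ->
     ~ embeds (BrownSteinThompson R q) (BrownSteinThompson R p))
  /\
  (forall I A1 P1 A2 P2 : set R,
     compact_interval_or_line I ->
     pos_subgroup P1 -> pos_subgroup P2 ->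
     is_submodule P1 A1 -> (exists2 a : R, A1 a & a != 0%R) ->
     is_submodule P2 A2 -> (exists2 a : R, A2 a & a != 0%R) ->
     abelian_rank_lt P2 P1 ->
     ~ embeds (BieriStrebel I A1 P1) (BieriStrebel I A2 P2)).
Proof.
split=> [m n p q m2 _ _ pp uq pq nm [phi [pH pM pI]]|
         I A1 P1 A2 P2 HI Pg1 Pg2 Am1 [a Aa a0] _ _ rk [phi [pH pM pI]]].
- have Pg := prime_slopes_group R pq; have Qg := prime_slopes_group R pp.
  have j : 'I_m := Ordinal (ltnW m2).
  have q1 : (1 < tnth q j)%N by apply: prime_gt1; exact: (all_tnthP pq).
  have Pq := pos_subgroupV Pg (prime_slope (R := R) (mem_tnth j q)).
  have q_lt1 : ((tnth q j)%:R : R)^-1 < 1.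
    by rewrite invf_lt1 ?ltr1n ?ltr0n // ltnW.
  (* any segment inside ]0, 1[ would do *)
  have a0 : (0 : R) < 1 / 4 by lra.
  have b1 : 3 / 4 < (1 : R) by lra.
  have E := PL_embedding_of_UI Pg (pos_subgroup1 Qg) a0 b1
    (@subset_refl _ (BrownSteinThompson R q)) (@subset_refl _ (BrownSteinThompson R p)) pH
    (fun h k Gh Gk => pM h k (mem_set Gh) (mem_set Gk))
    (fun h k Gh Gk => pI h k (mem_set Gh) (mem_set Gk)).
  have ab : (1 / 4 : R) < 3 / 4 by lra.
  have [chi chiH] := slope_hom_of_embedding Pg (prime_slopes_submodule R pq) Pq q_lt1
    (@subring_gen1 R _) (oner_neq0 R) ab E.
  exact: no_injective_hom_primes uq pp pq nm chiH.
- suff [chi chiH] : exists chi, injective_hom P1 P2 chi.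
    exact: injective_hom_abelian_rank Pg1 Pg2 chiH rk.
  (* for a trivial group of slopes the homomorphism is trivial *)
  have [[s [Ps s1]]|P1triv] := pselect (exists s, P1 s /\ s < 1); last first.
    have one s : P1 s -> s = 1.
      move=> Ps; have s0 := pos_subgroup_gt0 Pg1 Ps.
      have [s1|s1|//] := ltgtP s 1; first by case: P1triv; exists s.
      case: P1triv; exists s^-1; split; first exact: pos_subgroupV.
      by rewrite invf_lt1.
    exists (fun=> 1); split=> [s _|s t _ _|s t /one -> /one ->] //.
      exact: pos_subgroup1.
    by rewrite mulr1.
  have [b [c [bc bcI]]] : exists b c : R, b < c /\ `[b, c]%classic `<=` I.
    case: HI => [->|[b [c [bc ->]]]]; last by exists b, c; split.
    by exists 0, 1; split; [exact: ltr01|].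
  apply: (slope_hom_of_embedding Pg1 Am1 Ps s1 Aa a0 bc (phi := phi)).
  split=> [f /(BieriStrebel_sub bcI)/pH/BieriStrebel_PL//|f g|f g].
  + by move=> /(BieriStrebel_sub bcI) If /(BieriStrebel_sub bcI) Ig; apply: pM; rewrite in_setE.
  + by move=> /(BieriStrebel_sub bcI) If /(BieriStrebel_sub bcI) Ig; apply: pI; rewrite in_setE.
Qed.
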